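(* Let $\theta$ be a real number and let $G$ be a finite weighted multi-graph that has no $\theta$-Aomoto subset. Let $k=m_\theta(G)$ be the multiplicity of $\theta$ as a zero of the matching polynomial $\mu^G(x)$. Then there are $k$ pairwise disjoint cycles $C_1,\dots,C_k$ in $G$ such that $$m_\theta\bigl(G\setminus(C_1\sqcup\cdots\sqcup C_k)\bigr)=0.$$
   Context: A finite weighted multi-graph $G=(V(G),E(G))$ may have loops and parallel edges. Every edge (including a loop) corresponds to two mutually inverse arcs $e,e^{-1}$, with origin $o(e)$ and terminus $t(e)$; $\vec E(G)$ is the set of arcs. Each vertex $i$ has a weight $r_i\in\mathbb{R}$, and each arc $e$ has a weight $\rho_e\in\mathbb{C}$ with $\rho_{e^{-1}}=\overline{\rho_e}\neq 0$. Subgraphs inherit weights. The adjacency matrix is $A^G_{ij}=r_i\delta_{ij}+\sum_{e\in\vec E(G),\,o(e)=i,\,t(e)=j}\rho_e$, and eigenvalues of $G$ are those of $A^G$. For $S\subseteq V(G)$: $G[S]$ is the subgraph induced by $S$, $G\setminus S=G[V(G)\setminus S]$, and the frontier $\partial_G S$ is the set of vertices outside $S$ that have a neighbor in $S$. For a subgraph $H$, $G\setminus H=G\setminus V(H)$; $\mathrm{cc}(H)$ is the number of connected components of $H$. A loop is a cycle of length $1$ and two distinct parallel edges form a cycle of length $2$ (such cycles are allowed). A forest is a multi-graph without cycles. Matching polynomial: a matching is a set of edges forming a $1$-regular subgraph (so it contains no loops); for an edge $e$ put $\lambda_e=-|\rho_{\vec e}|^2$ with $\vec e$ either arc of $e$.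 Then $\mu^G(x)=\sum_{M}\prod_{i\notin M}(x-r_i)\prod_{e\in M}\lambda_e$, summing over all matchings $M$, where $i\notin M$ means that $i$ is not saturated by $M$ (the empty multi-graph has $\mu=1$). $m_\theta(G)$ is the multiplicity of $\theta$ as a zero of $\mu^G(x)$. A subset $S\subseteq V(G)$ is a $\theta$-Aomoto subset of $G$ if: $G[S]$ is a forest; $\theta$ is an eigenvalue of each component of $G[S]$; and $|\partial_G S|<\mathrm{cc}(G[S])$. *)

(* Defs.v *)
From mathcomp Require Import all_boot all_order all_algebra.
From mathcomp Require Import reals complex.

Set Implicit Arguments.
Unset Strict Implicit.
Unset Printing Implicit Defensive.

Import Order.TTheory GRing.Theory Num.Theory.
Local Open Scope ring_scope.

(* Vertices and arcs are taken in ambient finite types [V] and [A], so that a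
   subgraph has the same type as the graph. The values of the functions outside
   of [vset] and [aset] are irrelevant. An edge is a pair {e, ainv e}; a loop
   also consists of two distinct arcs. *)
Record wmgraph (R : realType) (V A : finType) := WMGraph {
  vset : {set V};
  aset : {set A};
  org  : A -> V;
  ainv : A -> A;
  vwt  : V -> R;
  awt  : A -> R[i];
  org_vset  : forall e, e \in aset -> org e \in vset;
  ainv_aset : forall e, e \in aset -> ainv e \in aset;
  ainvK     : forall e, e \in aset -> ainv (ainv e) = e;
  ainv_neq  : forall e, e \in aset -> ainv e != e;
  awt_ainv  : forall e, e \in aset -> awt (ainv e) = ((awt e)^*)%C;
  awt_neq0  : forall e, e \in aset -> awt e != 0
}.

Section Graph.
Variables (R : realType) (V A : finType).
Implicit Types (G : wmgraph R V A) (S : {set V}) (theta : R).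

Definition ter G (e : A) : V := org G (ainv G e).

Section Induced.
Variables (G : wmgraph R V A) (S : {set V}).

Definition induced_vset := vset G :&: S.
Definition induced_aset :=
  [set e in aset G | (org G e \in S) && (ter G e \in S)].

Fact induced_org e : e \in induced_aset -> org G e \in induced_vset.
Proof. by rewrite !inE => /and3P[/org_vset -> ->]. Qed.

Fact induced_ainv e : e \in induced_aset -> ainv G e \in induced_aset.
Proof.
by rewrite !inE /ter => /and3P[eG oS tS]; rewrite ainv_aset // tS ainvK // oS.
Qed.

Fact induced_sub e : e \in induced_aset -> e \in aset G.
Proof. by rewrite inE => /andP[]. Qed.

Definition induced : wmgraph R V A :=
  @WMGraph R V A induced_vset induced_aset (org G) (ainv G) (vwt G) (awt G)
    induced_org induced_ainv
    (fun e h => ainvK (induced_sub h)) (fun e h => ainv_neq (induced_sub h))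
    (fun e h => awt_ainv (induced_sub h)) (fun e h => awt_neq0 (induced_sub h)).

End Induced.

Definition delete G S := induced G (vset G :\: S).

Definition adjacent G (x y : V) : bool :=
  [exists e in aset G, (org G e == x) && (ter G e == y)].

Definition frontier G S : {set V} :=
  [set v in vset G :\: S | [exists w in S, adjacent G v w]].

(* Vertex sets of the connected components of [G]; the component with vertex
   set [K] is [induced G K]. *)
Definition components G : {set {set V}} :=
  equivalence_partition (connect (adjacent G)) (vset G).

(* Rows and columns are indexed by the vertices through [enum_val]. *)
Definition adjmx G : 'M[R[i]]_#|vset G| :=
  \matrix_(i, j)
    (((vwt G (enum_val i))%:C)%C *+ (i == j)
     + \sum_(e in aset G | (org G e == enum_val i) && (ter G e == enum_val j))
          awt G e).

Definition is_eigenvalue G theta : bool := eigenvalue (adjmx G) (theta%:C)%C.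

(* A cycle is given by the sequence of the arcs met in one traversal. The last
   conjunct only matters for two arcs, which must then belong to distinct
   parallel edges; a single loop arc is a cycle of length 1. *)
Definition is_cycle G (c : seq A) : bool :=
  [&& c != [::], all [in aset G] c,
      path.cycle (fun e f => ter G e == org G f) c,
      uniq (map (org G) c) & all (fun e => ainv G e \notin c) c].

Definition cycle_vset G (c : seq A) : {set V} := [set v in map (org G) c].

Definition is_forest G : Prop := forall c : seq A, ~~ is_cycle G c.

Definition edges G : {set {set A}} :=
  [set [set e; ainv G e] | e in aset G].

Definition saturated G (M : {set {set A}}) : {set V} := org G @: cover M.

(* The degree of a vertex is the number of arcs originating from it, so that a
   loop contributes 2 and never belongs to a matching. *)
Definition is_matching G (M : {set {set A}}) : bool :=
  (M \subset edges G) &&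
  [forall v in saturated G M, #|[set e in cover M | org G e == v]| == 1%N].

(* The two arcs of an edge have weights of equal modulus, so the choice made by
   [pick] does not matter; the [None] case does not occur. *)
Definition edge_wt G (f : {set A}) : R :=
  if [pick e in f] is Some e then - ComplexField.Normc.normc (awt G e) ^+ 2
  else 0.

Definition matching_poly G : {poly R} :=
  \sum_(M : {set {set A}} | is_matching G M)
    (\prod_(v in vset G :\: saturated G M) ('X - (vwt G v)%:P)
     * \prod_(f in M) (edge_wt G f)%:P).

Definition mult theta G : nat := mup theta (matching_poly G).

Definition aomoto theta G S : Prop :=
  [/\ S \subset vset G,
      is_forest (induced G S),
      forall K, K \in components (induced G S) ->
        is_eigenvalue (induced (induced G S) K) theta
    & (#|frontier G S| < #|components (induced G S)|)%N].

End Graph.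

(* Main.v *)
(** Let m(S) be the multiplicity of theta as a zero of the matching polynomial of
    G[S]. Deleting a vertex changes m by at most one. Let A be a maximal set with
    m(V \ A) = m(V) + |A|. Then every component K of G \ A with m(K) > 0 is
    critical (m drops at each of its vertices), and m(K) = 1 by an analogue of
    Gallai's lemma.

    If a critical component K has no cycle C with m(K \ C) = 0, then the residues
    of mu(K - v) / mu(K) and mu(K - u - v) / mu(K) at theta satisfy the same
    relations as in a tree; summing the vertex recursion over K gives |V| - |E| = 1.
    So K is a tree, and theta is an eigenvalue because the values mu(K - v) at theta
    are, up to a factor, the squared moduli of the entries of an eigenvector.

    As G has no Aomoto subset, Hall's theorem matches A with distinct critical
    components, all trees among them being used. This leaves m(V) critical
    components with a cycle as above. Once these cycles are deleted, the vertices
    of A can be put back without a zero at theta: all leading terms at theta of the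
    expansion along A have the same sign, and the matching gives a nonzero one. *)

Require Import Defs.
From mathcomp Require Import all_boot all_order all_algebra.
From mathcomp Require Import boolp reals complex.
From mathcomp Require Import ring zify.
Set Implicit Arguments.
Unset Strict Implicit.
Unset Printing Implicit Defensive.
Import Order.TTheory GRing.Theory Num.Theory.
Local Open Scope ring_scope.

(** * Hall's theorem, potentials on trees, components *)

(** No roots are ever listed: every statement about multiplicities is a divisibility by a power of X
    - theta. Positivity enters because the Wronskian of [mu S] and [mu (u |: S)] is a nonnegative
    combination of squares. A sum of real squares has even order, and no square in it has smaller
    order, so the bound 2n - 1 on the order of the Wronskian gives the bound n for each polynomial
    squared. This one gained order yields interlacing and the analogue of Gallai's lemma. The
    abstract part sees only total weights between distinct vertices, where loops and parallel edges
    are invisible. They are excluded afterwards: at theta neither mu(K - v) nor, for an edge uv,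
    mu(K - u - v) vanishes, so a loop or a pair of parallel edges would itself be a cycle of the
    forbidden kind. *)

Section Hall.
Variables (I J : finType) (j0 : J).
Implicit Types (r : I -> J -> bool) (D X : {set I}).

Definition neighbors r X : {set J} := [set j | [exists i in X, r i j]].

Lemma neighborsP r X j : reflect (exists2 i, i \in X & r i j) (j \in neighbors r X).
Proof. by rewrite inE; apply: exists_inP. Qed.

(* Halmos and Vaughan: either some proper nonempty subset is tight, and it can be
   matched separately from the rest, or any single edge can be matched first. *)
Lemma hall r D : (forall X, X \subset D -> (#|X| <= #|neighbors r X|)%N) ->
  exists f : I -> J, {in D &, injective f} /\ forall i, i \in D -> r i (f i).
Proof.
have [n] := ubnP #|D|; elim: n r D => // n IHn r D; rewrite ltnS => leDn H.
have [->|/set0Pn[i0 i0D]] := eqVneq D set0.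
  by exists (fun=> j0); split=> i; rewrite inE.
case: (pickP [pred X : {set I} | [&& X \proper D, X != set0 & #|neighbors r X| == #|X|]])
  => [X /= /and3P[XD X0 /eqP tight]|loose].
- have cX : (0 < #|X|)%N by rewrite card_gt0.
  have sXD := proper_sub XD; have cDX := cardsDS sXD; have ltXD := proper_card XD.
  have [||f1 [inj1 r1]] := IHn r X; first lia.
    by move=> Y YX; apply: H; apply: subset_trans sXD.
  pose r' i j := r i j && (j \notin neighbors r X).
  have [||f2 [inj2 r2]] := IHn r' (D :\: X).
  + lia.
  + move=> Y YDX; have := H (X :|: Y); rewrite subUset sXD (subset_trans YDX (subsetDl _ _)).
    move=> /(_ isT); have dXY : [disjoint X & Y].
      rewrite disjoint_sym; apply: disjointWl YDX _.
      by rewrite -setI_eq0 setIDAC -setIDA setDv setI0.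
    have -> : neighbors r (X :|: Y) = neighbors r X :|: neighbors r' Y.
      apply/setP => j; rewrite [RHS]inE; apply/neighborsP/orP => [[k]|].
        rewrite inE; have [jX|jX] := boolP (j \in neighbors r X); first by left.
        case/orP => [kX rkj|kY rkj]; first by case/negP: jX; apply/neighborsP; exists k.
        by right; apply/neighborsP; exists k => //; rewrite /r' rkj.
      case=> /neighborsP[i iX]; last move=> /andP[]; move=> rij *;
        by exists i; rewrite // inE iX ?orbT.
    have := leq_card_setU (neighbors r X) (neighbors r' Y).
    rewrite [#|X :|: Y|]cardsU (disjoint_setI0 dXY) cards0 tight => -[le1 _] le2; lia.
  exists (fun i => if i \in X then f1 i else f2 i); split=> [i j iD jD|i iD].
    case: (boolP (i \in X)) => iX; case: (boolP (j \in X)) => jX.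
    + exact: inj1.
    + move=> E; have := r2 j; rewrite !inE jX jD => /(_ isT) /andP[_ /neighborsP[]].
      by exists i => //; rewrite -E r1.
    + move=> E; have := r2 i; rewrite !inE iX iD => /(_ isT) /andP[_ /neighborsP[]].
      by exists j => //; rewrite E r1.
    by apply: inj2; rewrite !inE ?iX ?jX.
  case: (boolP (i \in X)) => iX; first exact: r1.
  by have := r2 i; rewrite !inE iX iD => /(_ isT) /andP[].
have : (0 < #|neighbors r [set i0]|)%N by rewrite (leq_trans _ (H _ _)) ?cards1 ?sub1set.
rewrite card_gt0 => /set0Pn[j1 /neighborsP[_ /set1P-> rij1]].
pose r' i j := r i j && (j != j1).
have cD := cardsD1 i0 D; rewrite i0D in cD.
have [||f [injf rf]] := IHn r' (D :\ i0); first lia.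
  move=> X XD; have [->|X0] := eqVneq X set0; first by rewrite cards0.
  have XpD : X \proper D by apply: sub_proper_trans XD _; rewrite properD1.
  have := loose X; rewrite /= XpD X0 /= => /negbT ne.
  have := H X (proper_sub XpD); rewrite leq_eqVlt eq_sym (negPf ne) /=.
  have : neighbors r X :\ j1 \subset neighbors r' X.
    apply/subsetP => j /setD1P[jj1 /neighborsP[i iX rij]]; apply/neighborsP.
    by exists i => //; rewrite /r' rij.
  move/subset_leq_card; have := cardsD1 j1 (neighbors r X); case: (_ \in _); lia.
exists (fun i => if i == i0 then j1 else f i); split=> [i j iD jD|i iD].
  have [->|ii0] := eqVneq i i0; have [->|ji0] := eqVneq j i0 => //.
  + by move=> E; have := rf j; rewrite !inE ji0 jD /r' -E eqxx andbF => /(_ isT).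
  + by move=> E; have := rf i; rewrite !inE ii0 iD /r' E eqxx andbF => /(_ isT).
  by apply: injf; rewrite !inE ?ii0 ?ji0.
have [->//|ii0] := eqVneq i i0.
by have := rf i; rewrite !inE ii0 iD => /(_ isT) /andP[].
Qed.

End Hall.

Section Linked.
Variables (V : finType) (e : rel V).
Hypotheses (e_sym : symmetric e) (e_irr : irreflexive e).
Implicit Types (K L S : {set V}) (P : {set {set V}}).

(** Connectedness without paths: a property that holds somewhere in [K] and passes to neighbors
    holds on all of [K]. *)
Definition linked K := forall L : {set V}, L \subset K -> L != set0 ->
  (forall x y, x \in L -> y \in K -> e x y -> y \in L) -> L = K.

(** Ordered pairs, so that each edge counts twice and [#|arcs K|.+2 = 2 * #|K|] means |V| - |E| =
    1. *)
Definition arcs K : {set V * V} := [set p | [&& p.1 \in K, p.2 \in K & e p.1 p.2]].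

Lemma card_arcsU1 L y : y \notin L ->
  #|arcs (y |: L)| = (#|arcs L| + 2 * #|[set z in L | e z y]|)%N.
Proof.
move=> yL; set N := [set z in L | e z y].
have yN : y \notin N by rewrite inE (negPf yL).
have -> : arcs (y |: L) = arcs L :|: (setX N [set y] :|: setX [set y] N).
  apply/setP => -[a b]; rewrite !inE /=.
  have [->|ay] := eqVneq a y; have [->|yb] := eqVneq b y;
    rewrite ?e_irr ?(negPf yL) ?andbF ?andbT ?orbF //=.
  by rewrite e_sym.
rewrite cardsU (_ : _ :&: _ = set0) ?cards0 ?subn0; last first.
  apply/setP => -[a b]; rewrite !inE /=.
  by have [->|ay] := eqVneq a y; have [->|yb] := eqVneq b y;
    rewrite ?e_irr ?(negPf yL) ?andbF.
rewrite cardsU (_ : _ :&: _ = set0) ?cards0 ?subn0; last first.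
  apply/setP => -[a b]; rewrite !inE /=.
  by have [->|ay] := eqVneq a y; have [->|yb] := eqVneq b y;
    rewrite ?e_irr ?(negPf yL) ?andbF.
by rewrite !cardsX !cards1 muln1 mul1n addnn mul2n.
Qed.

(* Vertices are added one at a time. The arc count forces each new vertex to have
   a single neighbor among the old ones, so the potential extends. *)
Lemma linked_potential (F : fieldType) K (g : V -> V -> F) :
  linked K -> (#|arcs K|.+2 = 2 * #|K|)%N ->
  (forall u v, u \in K -> v \in K -> e u v -> g u v * g v u = 1) ->
  exists x : V -> F, (forall v, v \in K -> x v != 0) /\
    forall u v, u \in K -> v \in K -> e u v -> x v = x u * g u v.
Proof.
move=> lK cK gK; pose potential L (x : V -> F) := (forall v, v \in L -> x v != 0) /\
    forall u v, u \in L -> v \in L -> e u v -> x v = x u * g u v.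
(* The excess [#|arcs L| + 2 - 2 * #|L|] never decreases as neighbors are added; once positive it
   stays so, which contradicts [cK] at [L = K]. *)
suff grow n : (0 < n <= #|K|)%N -> exists L, [/\ L \subset K, #|L| = n &
    (2 * n < #|arcs L|.+2)%N \/ (#|arcs L|.+2 = 2 * n)%N /\ exists x, potential L x].
  have [|L [LK cL]] := grow #|K|; first by rewrite leqnn andbT; lia.
  have -> : L = K by apply/eqP; rewrite eqEcard LK cL leqnn.
  by rewrite cK ltnn => -[//|[_]].
elim: n => // -[_|n IHn] leK.
  have /set0Pn[v vK] : K != set0 by rewrite -card_gt0; case/andP: leK.
  exists [set v]; split; rewrite ?sub1set ?cards1 //; right; split.
    rewrite (_ : arcs _ = set0) ?cards0 //; apply/setP => -[a b]; rewrite !inE /=.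
    by have [->|//] := eqVneq a v; have [->|//] := eqVneq b v; rewrite e_irr.
  exists (fun=> 1); split=> [u _|a b /set1P-> /set1P->]; first exact: oner_neq0.
  by rewrite e_irr.
have [|L [LK cL HL]] := IHn; first lia.
have [x0 [y [x0L yK yL ex0y]]] : exists x0 y, [/\ x0 \in L, y \in K, y \notin L & e x0 y].
  case: (pickP [pred p : V * V | [&& p.1 \in L, p.2 \in K, p.2 \notin L & e p.1 p.2]]).
    by move=> [a b] /= /and4P[aL bK bL eab]; exists a, b.
  move=> none; have LE : L = K.
    apply: lK => //; first by rewrite -card_gt0 cL.
    move=> a b aL bK eab; apply: contraFT (none (a, b)) => bL /=.
    by rewrite aL bK bL eab.
  by move: leK; rewrite -LE cL ltnn.
exists (y |: L); split; first by rewrite subUset sub1set yK.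
  by rewrite cardsU1 yL cL.
rewrite card_arcsU1 //; set N := [set z in L | e z y].
have x0N : x0 \in N by rewrite inE x0L.
have cN : (0 < #|N|)%N by rewrite card_gt0; apply/set0Pn; exists x0.
case: HL => [gt|[cA [x [x_neq0 xg]]]]; first by left; lia.
have [gt1|le1] := ltnP 1 #|N|; first by left; lia.
have N1 : N = [set x0].
  by apply/esym/eqP; rewrite eqEcard sub1set x0N cards1.
right; split; first by rewrite N1 cards1; lia.
have only z : z \in L -> e z y -> z = x0.
  by move=> zL ezy; apply/set1P; rewrite -N1 inE zL.
have neq z : z \in L -> (z == y) = false by move=> zL; apply: contraNF yL => /eqP <-.
have gx0 := gK _ _ (subsetP LK _ x0L) yK ex0y.
exists (fun z => if z == y then x x0 * g x0 y else x z); split=> [v|a b].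
  case/setU1P => [->|vL]; last by rewrite neq // x_neq0.
  rewrite eqxx mulf_neq0 ?x_neq0 //.
  by apply: contra_eq_neq gx0 => ->; rewrite mul0r eq_sym oner_neq0.
case/setU1P => [->|aL]; case/setU1P => [->|bL]; rewrite ?eqxx ?neq //.
- by rewrite e_irr.
- by rewrite e_sym => /only -> //; rewrite -mulrA gx0 mulr1.
- by move/only => ->.
exact: xg.
Qed.

(** By [blocks_unique] these conditions characterize the connected components of [S]; this
    identifies the blocks for positive weights with [components] of the multi-graph. *)
Definition blocks (P : {set {set V}}) (S : {set V}) :=
  [/\ partition P S, forall K, K \in P -> linked K
    & forall K x y, K \in P -> x \in K -> y \in S -> e x y -> y \in K].

(** If two blocks meet, their intersection is closed under adjacency in both, so it equals both. *)
Lemma blocks_sub P P' S : blocks P S -> blocks P' S -> P \subset P'.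
Proof.
move=> [pP lP cP] [pP' lP' cP']; have /and3P[/eqP covP trivP P0] := pP.
have /and3P[/eqP covP' trivP' P'0] := pP'.
apply/subsetP => K KP; have /set0Pn[x xK] : K != set0 by apply: contraNneq P0 => <-.
have KS : K \subset S by rewrite -covP; apply: (bigcup_max K).
have : x \in cover P' by rewrite covP' (subsetP KS).
case/bigcupP => K' K'P' xK'.
have K'S : K' \subset S by rewrite -covP'; apply: (bigcup_max K').
have KI0 : K :&: K' != set0 by apply/set0Pn; exists x; rewrite inE xK.
have <- : K :&: K' = K.
  apply: (lP K KP) => // [|a b]; first exact: subsetIl.
  case/setIP => aK aK' bK eab; rewrite inE bK.
  by apply: (cP' K' a) => //; apply: (subsetP KS).
suff -> : K :&: K' = K' by [].
apply: (lP' K' K'P') => // [|a b]; first exact: subsetIr.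
case/setIP => aK aK' bK' eab; rewrite inE bK' andbT.
by apply: (cP K a) => //; apply: (subsetP K'S).
Qed.

Lemma blocks_unique P P' S : blocks P S -> blocks P' S -> P = P'.
Proof. by move=> bP bP'; apply/eqP; rewrite eqEsubset !(@blocks_sub _ _ S). Qed.

(** [a] and [e] are compared off the diagonal only, because [adjacent] holds at a vertex with a loop
    while [e] is irreflexive. *)
Lemma blocks_connect (a : rel V) S : symmetric a ->
  (forall x y, a x y -> y \in S) ->
  (forall x y, x \in S -> y \in S -> x != y -> a x y = e x y) ->
  blocks (equivalence_partition (connect a) S) S.
Proof.
move=> a_sym aS ae; have csym : connect_sym a by exact: sym_connect_sym.
have part : partition (equivalence_partition (connect a) S) S.
  apply/equivalence_partitionP => x y z _ _ _; split; first exact: connect0.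
  by move=> xy; rewrite (same_connect csym xy).
split=> // [K /imsetP[x xS ->] L LK /set0Pn[z zL] Lclosed|K x y /imsetP[z zS ->]].
  apply/eqP; rewrite eqEsubset LK; apply/subsetP => y; rewrite inE => /andP[yS xy].
  have /setIdP[zS xz] := subsetP LK z zL.
  have /connectP[p pth ->] : connect a z y by rewrite -(same_connect csym xz).
  elim: p z zL zS xz pth => //= z' p IHp z zL zS xz /andP[azz' pth].
  have z'S := aS _ _ azz'; have xz' := connect_trans xz (connect1 azz').
  apply: IHp pth => //; have [<-//|zz'] := eqVneq z z'.
  by apply: Lclosed zL _ _; rewrite -?ae // inE z'S.
rewrite !inE => /andP[xS zx] yS exy; rewrite yS (connect_trans zx) //.
apply: connect1; rewrite ae //; by apply: contraTneq exy => ->; rewrite e_irr.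
Qed.

Lemma blocks_exist S : exists P, blocks P S.
Proof.
pose a x y := [&& x \in S, y \in S & e x y].
exists (equivalence_partition (connect a) S); apply: blocks_connect.
- by move=> x y; rewrite /a e_sym; case: (x \in S); case: (y \in S).
- by move=> x y /and3P[].
by move=> x y xS yS _; rewrite /a xS yS.
Qed.

Lemma blocks_cover P S (T : {set {set V}}) : blocks P S -> T \subset P -> blocks T (cover T).
Proof.
move=> [/and3P[/eqP covP trivP P0] lP cP] TP; split.
- apply/and3P; split=> //; first exact: trivIsetS trivP.
  by apply: contra P0; apply: subsetP.
- by move=> K KT; apply: lP; apply: (subsetP TP).
move=> K x y KT xK yT; apply: cP => //; first exact: (subsetP TP).
rewrite -covP; case/bigcupP: yT => K' K'T yK'; apply/bigcupP; exists K' => //.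
exact: (subsetP TP).
Qed.

End Linked.

(** * Orders of vanishing and sums of real squares *)

Lemma deriv_sum (R : nzRingType) (I : Type) (s : seq I) (P : pred I)
    (F : I -> {poly R}) :
  (\sum_(i <- s | P i) F i)^`() = \sum_(i <- s | P i) (F i)^`().
Proof. exact: (raddf_sum (@deriv R)). Qed.

Lemma exp_dvdp_deriv (R : fieldType) (q p : {poly R}) n :
  q ^+ n %| p -> q ^+ n.-1 %| p^`().
Proof.
case/dvdpP => g ->; rewrite derivM deriv_exp; apply: dvdp_add.
  by apply: dvdp_mull; apply: dvdp_exp2l; lia.
by rewrite -mulr_natl; do 3!apply: dvdp_mull.
Qed.

Lemma dvdp_sum (R : fieldType) (I : Type) (s : seq I) (P : pred I)
    (F : I -> {poly R}) d :
  (forall i, P i -> d %| F i) -> d %| \sum_(i <- s | P i) F i.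
Proof.
by move=> dF; apply: (big_ind (fun f => d %| f)) => [|f g|i]; [|apply: dvdp_add|apply: dF].
Qed.

(** Modulo t^(n+1) the derivative of g t^(n+1) is (n+1) g t^n, which is nonzero in characteristic
    zero as g does not vanish at [x]. *)
Lemma mup_deriv_ndvdp (R : numFieldType) (x : R) (p : {poly R}) n :
  p != 0 -> mup x p = n.+1 -> ~~ (('X - x%:P) ^+ n.+1 %| p^`()).
Proof.
move=> p0 pn; set t := 'X - x%:P.
have t_neq0 k : t ^+ k != 0 by rewrite expf_neq0 // polyXsubC_eq0.
have /dvdpP[g pE] : t ^+ n.+1 %| p by rewrite -mup_geq // pn.
have gx : ~~ root g x.
  apply: contraTN isT; rewrite -dvdp_XsubCl => tg.
  have : t ^+ n.+2 %| p by rewrite pE exprS dvdp_mul2r.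
  by rewrite -mup_geq // pn ltnn.
rewrite pE derivM dvdp_addr; last exact: dvdp_mull.
rewrite deriv_exp derivXsubC mul1r /=.
rewrite -mulr_natl mulrCA mulrA exprS dvdp_mul2r // dvdp_XsubCl.
by rewrite rootM negb_or gx andbT -polyC_natr rootC pnatr_eq0.
Qed.

(** The Wronskian of [Q * s ^+ n] and [P * s ^+ n.+1] for s' = 1, with the derivatives as free
    variables; its leading term is [s ^+ n.*2 * (Q * P)]. *)
Lemma wronskian_expX (A : comNzRingType) (s P Q P' Q' : A) n :
  Q * s ^+ n * (P' * s ^+ n.+1 + P * (s ^+ n *+ n.+1))
  - P * s ^+ n.+1 * (Q' * s ^+ n + Q * (1 * s ^+ n.-1 *+ n))
  = s ^+ n.*2 * (Q * P + s * (Q * P' - P * Q')).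
Proof.
rewrite mul1r -addnn exprD exprS.
have -> : P * (s * s ^+ n) * (Q' * s ^+ n + Q * (s ^+ n.-1 *+ n))
    = P * s ^+ n * (Q' * s * s ^+ n + Q * (s ^+ n *+ n)).
  case: n => [|n] /=; first by rewrite !mulr0n expr0; ring.
  rewrite exprS -(mulr_natr (s ^+ n)) -(mulr_natr (s * s ^+ n)).
  by move: (s ^+ n) (n.+1%:R) => u c; ring.
by rewrite mulrSr -(mulr_natr (s ^+ n)); move: (s ^+ n) (n%:R) => u c; ring.
Qed.

Section SumsOfSquares.
Variable R : rcfType.
Implicit Types (f g p : {poly R}) (x : R).

Definition sos f := exists l : seq {poly R}, f = \sum_(g <- l) g ^+ 2.

Lemma sos0 : sos 0.
Proof. by exists [::]; rewrite big_nil. Qed.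

Lemma sos_sqr g : sos (g ^+ 2).
Proof. by exists [:: g]; rewrite big_seq1. Qed.

Lemma sosD f g : sos f -> sos g -> sos (f + g).
Proof. by move=> [k ->] [l ->]; exists (k ++ l); rewrite big_cat. Qed.

Lemma sosZ c f : 0 <= c -> sos f -> sos (c *: f).
Proof.
move=> c_ge0 [l ->]; exists [seq Num.sqrt c *: g | g <- l].
rewrite big_map scaler_sumr; apply: eq_bigr => g _.
by rewrite exprZn sqr_sqrtr.
Qed.

Lemma sos_sum (I : finType) (P : pred I) (F : I -> {poly R}) :
  (forall i, P i -> sos (F i)) -> sos (\sum_(i | P i) F i).
Proof. by move=> sosF; apply: big_ind => //; [apply: sos0 | apply: sosD]. Qed.

(** Once the common factor t^(2n) is divided out, a sum of real squares that vanishes at [x] forces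
    every term to vanish there. So orders are even, and the exponent [n.*2.-1] already suffices. *)
Lemma sqr_sum_dvdp x n (l : seq {poly R}) :
  ('X - x%:P) ^+ n.*2.-1 %| \sum_(g <- l) g ^+ 2 ->
  forall g, g \in l -> ('X - x%:P) ^+ n %| g.
Proof.
elim: n => [|n IHn] t_dvd g gl; first by rewrite expr0 dvd1p.
have {IHn} h_ex g' : g' \in l -> g' = (g' %/ ('X - x%:P) ^+ n) * ('X - x%:P) ^+ n.
  move=> g'l; rewrite divpK // IHn //; apply: dvdp_trans t_dvd.
  by rewrite dvdp_exp2l //; lia.
set t := 'X - x%:P in t_dvd h_ex *.
have sumE : \sum_(g' <- l) g' ^+ 2 = t ^+ n.*2 * \sum_(g' <- l) (g' %/ t ^+ n) ^+ 2.
  rewrite big_distrr /=; apply: eq_big_seq => g' g'l.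
  by rewrite {1}(h_ex g' g'l) exprMn -exprM muln2 mulrC.
have t_neq0 : t ^+ n.*2 != 0 by rewrite expf_neq0 // polyXsubC_eq0.
move: t_dvd; rewrite sumE doubleS /= exprSr dvdp_mul2l // dvdp_XsubCl.
rewrite rootE horner_sum big_seq psumr_eq0 => [/allP /(_ g gl)|g' _]; last first.
  by rewrite horner_exp sqr_ge0.
rewrite gl horner_exp sqrf_eq0 -rootE -dvdp_XsubCl -/t => t_dvd.
by rewrite (h_ex g gl) exprS dvdp_mul2r ?expf_neq0 ?polyXsubC_eq0.
Qed.

Lemma sosD_dvdp x n f g : sos f -> sos g ->
  ('X - x%:P) ^+ n.*2.-1 %| f + g -> ('X - x%:P) ^+ n.*2 %| f.
Proof.
move=> [k ->] [l ->]; rewrite -big_cat => /sqr_sum_dvdp t_dvd.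
rewrite big_seq; apply: dvdp_sum => h hk.
by rewrite -muln2 exprM dvdp_exp2r // t_dvd // mem_cat hk.
Qed.

Lemma sosD_dvdp_sqr x n g f : sos f ->
  ('X - x%:P) ^+ n.*2.-1 %| g ^+ 2 + f -> ('X - x%:P) ^+ n %| g.
Proof.
move=> [l ->] /=; have -> : g ^+ 2 + \sum_(h <- l) h ^+ 2 = \sum_(h <- g :: l) h ^+ 2.
  by rewrite big_cons.
by move=> /sqr_sum_dvdp; apply; rewrite mem_head.
Qed.

Lemma sos_horner_ge0 f x : sos f -> 0 <= f.[x].
Proof.
move=> [l ->]; rewrite horner_sum sumr_ge0 // => g _.
by rewrite horner_exp sqr_ge0.
Qed.

(** Each square is divisible by t^(2n), so the quotient [f] is again a sum of squares. *)
Lemma sos_divX x n f : sos (('X - x%:P) ^+ n.*2 * f) -> 0 <= f.[x].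
Proof.
move=> [l fE]; have t_dvd g : g \in l -> ('X - x%:P) ^+ n %| g.
  apply: sqr_sum_dvdp; rewrite -fE; apply: dvdp_mulr.
  by rewrite dvdp_exp2l //; lia.
have t_neq0 : ('X - x%:P) ^+ n.*2 != 0 by rewrite expf_neq0 // polyXsubC_eq0.
suff -> : f = \sum_(g <- l) (g %/ ('X - x%:P) ^+ n) ^+ 2.
  by apply: sos_horner_ge0; exists [seq g %/ ('X - x%:P) ^+ n | g <- l]; rewrite big_map.
apply: (mulfI t_neq0); rewrite fE big_distrr /=; apply: eq_big_seq => g gl.
by rewrite -{1}(divpK (t_dvd g gl)) exprMn -exprM muln2 mulrC.
Qed.

End SumsOfSquares.

(** * Multiplicities *)

Section Mu.
Variables (R : rcfType) (V : finType) (w : V -> V -> R) (r : V -> R).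
(* [mu S] plays the matching polynomial of the subgraph induced by [S]; the vertex
   recursion is all that is needed. *)
Variable mu : {set V} -> {poly R}.
Hypothesis w_ge0 : forall u v, 0 <= w u v.
Hypothesis w_sym : forall u v, w u v = w v u.
Hypothesis mu0 : mu set0 = 1.
Hypothesis muD1 : forall (S : {set V}) v, v \in S ->
  mu S = ('X - (r v)%:P) * mu (S :\ v)
         - \sum_(y in S :\ v) w v y *: mu (S :\ v :\ y).
Implicit Types (S X Y K Q Z A : {set V}) (P : {set {set V}}) (u v y : V).

Let e : rel V := fun x y => 0 < w x y.

Lemma muU1 X v : v \notin X ->
  mu (v |: X) = ('X - (r v)%:P) * mu X - \sum_(y in X) w v y *: mu (X :\ y).
Proof. by move=> vX; rewrite (muD1 (setU11 v X)) setU1K. Qed.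

Lemma mu_monic_size S : mu S \is monic /\ size (mu S) = #|S|.+1.
Proof.
have [n] := ubnP #|S|; elim: n S => // n IHn S; rewrite ltnS => leSn.
have [->|/set0Pn[v vS]] := eqVneq S set0.
  by rewrite mu0 monic1 size_poly1 cards0.
have cS := cardsD1 v S; rewrite vS /= in cS.
have [mon1 size1] : mu (S :\ v) \is monic /\ size (mu (S :\ v)) = #|S :\ v|.+1.
  by apply: IHn; lia.
rewrite (muD1 vS); set p := _ * _; set q := \sum_(y in _) _.
have monp : p \is monic by rewrite monicMl ?monicXsubC.
have sizep : size p = #|S|.+1.
  by rewrite size_monicM ?monicXsubC ?monic_neq0 // size_XsubC size1 /=; lia.
have sizeq : (size (- q) < size p)%N.
  rewrite size_polyN sizep /q; apply: (big_ind (fun h : {poly R} => (size h < #|S|.+1)%N)).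
  - by rewrite size_poly0.
  - by move=> f g sf sg; apply: leq_ltn_trans (size_polyD _ _) _; rewrite gtn_max sf.
  move=> y yS; apply: leq_ltn_trans (size_scale_leq _ _) _.
  have cy := cardsD1 y (S :\ v); rewrite yS in cy.
  by have [|_ ->] := IHn (S :\ v :\ y); lia.
by rewrite monicE lead_coefDl // size_polyDl // sizep -monicE.
Qed.

Lemma mu_neq0 S : mu S != 0.
Proof. by apply: monic_neq0; case: (mu_monic_size S). Qed.

(* Unfolding [delta_rec] expresses [delta] as a sum over paths from [v] through
   [X :&: Y] to the symmetric difference of [X] and [Y]. For [X = S :\: [set u; v]]
   and [Y = S :\ v] this is the Heilmann-Lieb identity. *)
Definition delta X Y v : {poly R} := mu (v |: X) * mu Y - mu X * mu (v |: Y).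

Lemma delta_rec X Y v : v \notin X -> v \notin Y ->
  delta X Y v =
    \sum_(y in X :&: Y) w v y *: delta (X :\ y) (Y :\ y) y
    - \sum_(y in X :\: Y) w v y *: (mu (X :\ y) * mu Y)
    + \sum_(y in Y :\: X) w v y *: (mu X * mu (Y :\ y)).
Proof.
move=> vX vY; rewrite /delta !muU1 //.
rewrite (big_setID Y) /= [X in _ - _ * (_ - X)](big_setID X) /= [Y :&: X]setIC.
have -> : \sum_(y in X :&: Y) w v y *:
      (mu (y |: X :\ y) * mu (Y :\ y) - mu (X :\ y) * mu (y |: Y :\ y))
    = mu X * (\sum_(y in X :&: Y) w v y *: mu (Y :\ y))
      - (\sum_(y in X :&: Y) w v y *: mu (X :\ y)) * mu Y.
  rewrite big_distrr big_distrl /= -sumrB; apply: eq_bigr => y /setIP[yX yY].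
  by rewrite !setD1K // scalerBr scalerAr scalerAl.
have -> : \sum_(y in X :\: Y) w v y *: (mu (X :\ y) * mu Y)
    = (\sum_(y in X :\: Y) w v y *: mu (X :\ y)) * mu Y.
  by rewrite big_distrl; apply: eq_bigr => y _; rewrite scalerAl.
have -> : \sum_(y in Y :\: X) w v y *: (mu X * mu (Y :\ y))
    = mu X * (\sum_(y in Y :\: X) w v y *: mu (Y :\ y)).
  by rewrite big_distrr; apply: eq_bigr => y _; rewrite scalerAr.
ring.
Qed.

(** For nested sets the negative sum of [delta_rec] is empty; the paths run inside [X] and stop on
    first reaching [T]. *)
Lemma deltaU_rec X v (T : {set V}) : v \notin X -> v \notin T -> [disjoint X & T] ->
  delta X (X :|: T) v =
    \sum_(y in X) w v y *: delta (X :\ y) (X :\ y :|: T) y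
    + \sum_(y in T) w v y *: (mu X * mu (X :|: (T :\ y))).
Proof.
move=> vX vT dXT; rewrite delta_rec //; last by rewrite inE negb_or vX.
have XT z : z \in T -> z \notin X by move=> zT; rewrite (disjointFl dXT zT).
have -> : X :&: (X :|: T) = X by apply/setIidPl/subsetUl.
have -> : X :\: (X :|: T) = set0 by apply/eqP; rewrite setD_eq0 subsetUl.
rewrite big_set0 subr0; congr (_ + _).
  apply: eq_bigr => y yX; congr (_ *: delta _ _ _); rewrite setDUl; congr (_ :|: _).
  by apply/setP=> z; rewrite !inE; case: eqP => [->|//]; rewrite (disjointFr dXT yX).
have -> : (X :|: T) :\: X = T.
  apply/setP=> z; rewrite !inE; case: (boolP (z \in X)) => //= zX.
  by rewrite (disjointFr dXT zX).
apply: eq_bigr => y yT; congr (_ *: (_ * mu _)); apply/setP=> z; rewrite !inE.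
by case: eqP => [->|//]; rewrite (negPf (XT y yT)).
Qed.

Definition wronskian S u : {poly R} :=
  mu S * (mu (u |: S))^`() - mu (u |: S) * (mu S)^`().

(** Iterated, this is an identity of Christoffel-Darboux type: the Wronskian is a sum over paths
    from [u] through [S], each giving its weight times the square of [mu] of what it leaves of
    [S]. *)
Lemma wronskian_rec S u : u \notin S ->
  wronskian S u = mu S ^+ 2 + \sum_(y in S) w u y *: wronskian (S :\ y) y.
Proof.
move=> uS; rewrite /wronskian !muU1 //.
have -> : \sum_(y in S) w u y *:
      (mu (S :\ y) * (mu (y |: S :\ y))^`() - mu (y |: S :\ y) * (mu (S :\ y))^`())
    = (\sum_(y in S) w u y *: mu (S :\ y)) * (mu S)^`()
      - mu S * (\sum_(y in S) w u y *: mu (S :\ y))^`().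
  rewrite deriv_sum big_distrr big_distrl /= -sumrB; apply: eq_bigr => y yS.
  by rewrite !setD1K // derivZ scalerBr -scalerAl -scalerAr.
by rewrite derivB derivM derivXsubC; ring.
Qed.

(* A real sum of squares vanishes to even order, and each square at least to that
   order; this is what forces interlacing. *)
Lemma wronskian_sos S u : u \notin S -> sos (wronskian S u).
Proof.
have [n] := ubnP #|S|; elim: n S u => // n IHn S u; rewrite ltnS => leSn uS.
rewrite wronskian_rec //; apply: sosD; first exact: sos_sqr.
apply: sos_sum => y yS; apply: sosZ => //; apply: IHn; last by rewrite !inE eqxx.
by rewrite (cardsD1 y) yS in leSn.
Qed.

(** The recursion at one fixed [v] is applied to every [mu (S :\ x)] with [x != v]; the term [x = v]
    comes from the derivative of the linear factor. *)
Lemma deriv_mu S : (mu S)^`() = \sum_(v in S) mu (S :\ v).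
Proof.
have [n] := ubnP #|S|; elim: n S => // n IHn S; rewrite ltnS => leSn.
have [->|/set0Pn[v vS]] := eqVneq S set0; first by rewrite mu0 derivC big_set0.
have cS := cardsD1 v S; rewrite vS /= in cS.
rewrite (big_setD1 v) //= {1}(muD1 vS) derivB derivM derivXsubC mul1r -addrA; congr (_ + _).
rewrite IHn; last lia.
have E x : x \in S :\ v -> mu (S :\ x) = ('X - (r v)%:P) * mu (S :\ v :\ x)
    - \sum_(y in S :\ v | y != x) w v y *: mu (S :\ v :\ x :\ y).
  rewrite !inE => /andP[xv xS].
  have vSx : v \in S :\ x by rewrite !inE eq_sym xv.
  have Sxv : S :\ x :\ v = S :\ v :\ x by rewrite setDDl setUC -setDDl.
  rewrite (muD1 vSx) !Sxv; congr (_ - _).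
  by apply: eq_bigl => y; rewrite !inE andbC.
rewrite [RHS](eq_bigr _ E) sumrB -mulr_sumr; congr (_ - _).
rewrite deriv_sum [RHS](exchange_big_dep (mem (S :\ v))) /=; last by move=> x y _ /andP[].
apply: eq_bigr => y yS; rewrite derivZ IHn; last first.
  by have := cardsD1 y (S :\ v); rewrite yS; lia.
rewrite scaler_sumr; apply: eq_big => [x|x _].
  by rewrite [LHS]in_setD1 yS /= andbC [x == y]eq_sym.
by rewrite setDDl [[set y] :|: _]setUC -setDDl.
Qed.

Lemma muU S X : [disjoint S & X] ->
  (forall u v, u \in S -> v \in X -> w u v = 0) -> mu (S :|: X) = mu S * mu X.
Proof.
have [n] := ubnP #|S|; elim: n S => // n IHn S; rewrite ltnS => leSn dSX wSX.
have [->|/set0Pn[v vS]] := eqVneq S set0; first by rewrite set0U mu0 mul1r.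
have cS := cardsD1 v S; rewrite vS /= in cS.
have vX : v \notin X by rewrite (disjointFr dSX vS).
have E : (S :|: X) :\ v = S :\ v :|: X.
  by apply/setP => z; rewrite !inE; case: eqP => [->|//]; rewrite (negPf vX).
have IH (Z : {set V}) : Z \subset S -> (#|Z| < n)%N -> mu (Z :|: X) = mu Z * mu X.
  move=> ZS cZ; apply: IHn => //; first by apply: disjointWl dSX.
  by move=> a b aZ bX; apply: wSX => //; apply: (subsetP ZS).
have vSX : v \in S :|: X by rewrite inE vS.
rewrite (muD1 vS) (muD1 vSX) E // IH ?subsetDl //; last lia.
rewrite [RHS]mulrBl -mulrA; congr (_ - _).
rewrite (big_setID (S :\ v)) /= [X in _ + X]big1 ?addr0; last first.
  move=> y; rewrite !inE => /andP[yS /orP[ |yX]]; first by rewrite (negPf yS).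
  by rewrite wSX // scale0r.
rewrite (setIidPr _) ?subsetUl // big_distrl /=; apply: eq_bigr => y yS.
rewrite -scalerAl; congr (_ *: _).
have yX : y \notin X by case/setD1P: yS => _ yS; rewrite (disjointFr dSX yS).
have -> : (S :\ v :|: X) :\ y = S :\ v :\ y :|: X.
  apply/setP => z; rewrite !inE; case: eqP => [->|//]; by rewrite (negPf yX).
rewrite IH //; first by rewrite setDDl subsetDl.
by have := cardsD1 y (S :\ v); rewrite yS; lia.
Qed.


(** * Interlacing: the effect of deletions on the multiplicity *)

Variable theta : R.
Let t : {poly R} := 'X - theta%:P.
Let m S := mup theta (mu S).

Lemma m_geq S n : (n <= m S)%N = (t ^+ n %| mu S).
Proof. by rewrite /m mup_geq ?mu_neq0. Qed.

Lemma wronskian_dvdp S u a b :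
  t ^+ a %| mu S -> t ^+ b %| mu (u |: S) -> t ^+ (a + b).-1 %| wronskian S u.
Proof.
move=> ta tb; have wlogd p q i j : t ^+ i %| p -> t ^+ j %| q -> t ^+ (i + j).-1 %| p * q^`().
  move=> tp /exp_dvdp_deriv tq; apply: dvdp_trans (dvdp_mul tp tq).
  by rewrite -exprD dvdp_exp2l //; lia.
by apply: dvdp_sub; [apply: wlogd | rewrite addnC; apply: wlogd].
Qed.

(** [mu S ^+ 2] is the term of the path that stays at [u]. *)
Lemma wronskian_dvdp_base S u n : u \notin S ->
  t ^+ n.*2.-1 %| wronskian S u -> t ^+ n %| mu S.
Proof.
move=> uS; rewrite wronskian_rec //; apply: sosD_dvdp_sqr.
apply: sos_sum => y yS; apply: sosZ => //; apply: wronskian_sos.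
by rewrite !inE eqxx.
Qed.

(** The paths whose first edge is [u y] make up [wronskian (S :\ y) y], so a bound on the order
    moves along a path. *)
Lemma wronskian_dvdp_next S u y n : u \notin S -> y \in S -> 0 < w u y ->
  t ^+ n.*2.-1 %| wronskian S u -> t ^+ n.*2.-1 %| wronskian (S :\ y) y.
Proof.
move=> uS yS wuy; rewrite wronskian_rec // (big_setD1 y) //= addrCA => t_dvd.
have sosW z : sos (w u z *: wronskian (S :\ z) z).
  by apply: sosZ => //; apply: wronskian_sos; rewrite !inE eqxx.
have := sosD_dvdp (sosW y) (sosD (sos_sqr _) (sos_sum (fun z _ => sosW z))) t_dvd.
rewrite dvdpZr ?gt_eqF //; apply: dvdp_trans.
by rewrite dvdp_exp2l //; lia.
Qed.

(** A jump by two would make the Wronskian vanish to order [2 * m S + 1], hence [mu S] to order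
    [m S + 1]. *)
Lemma m_leU1 S u : u \notin S -> (m (u |: S) <= (m S).+1)%N.
Proof.
move=> uS; rewrite leqNgt; apply/negP => ltm.
have : t ^+ (m S).+1 %| mu S.
  apply: (wronskian_dvdp_base uS).
  apply: dvdp_trans (wronskian_dvdp (a := m S) (b := m (u |: S)) _ _).
  - by rewrite dvdp_exp2l //; lia.
  - by rewrite -m_geq.
  by rewrite -m_geq.
by rewrite -m_geq ltnn.
Qed.

Lemma m_leD1 S u : u \in S -> (m S <= (m (S :\ u)).+1)%N.
Proof. by move=> uS; have := @m_leU1 (S :\ u) u; rewrite setD1K // => -> //; rewrite !inE eqxx. Qed.

(** If the multiplicity rose by two, every polynomial in the vertex recursion at [u] would vanish to
    order [m S + 1] by [m_leD1], and so would [mu S]. *)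
Lemma m_geD1 S u : u \in S -> (m (S :\ u) <= (m S).+1)%N.
Proof.
move=> uS; rewrite leqNgt; apply/negP => ltm.
suff: ((m S).+1 <= m S)%N by rewrite ltnn.
rewrite m_geq (muD1 uS); apply: dvdp_sub.
  by apply: dvdp_mull; rewrite -m_geq; lia.
apply: dvdp_sum => y yS.
rewrite -mul_polyC; apply: dvdp_mull; rewrite -m_geq.
by have := m_leD1 yS; lia.
Qed.

Lemma m_leD S X : X \subset S -> (m S <= m (S :\: X) + #|X|)%N.
Proof.
have [n] := ubnP #|X|; elim: n X => // n IHn X; rewrite ltnS => leXn XS.
have [->|/set0Pn[x xX]] := eqVneq X set0; first by rewrite setD0 cards0 addn0.
have cX := cardsD1 x X; rewrite xX in cX.
have /IHn IH : (#|X :\ x| < n)%N by lia.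
have := IH (subset_trans (subsetDl _ _) XS).
have xS : x \in S :\: (X :\ x) by rewrite !inE eqxx (subsetP XS).
by have := m_leD1 xS; rewrite setDDl setUC setD1K //; lia.
Qed.

Lemma m_geD S X : X \subset S -> (m (S :\: X) <= m S + #|X|)%N.
Proof.
have [n] := ubnP #|X|; elim: n X => // n IHn X; rewrite ltnS => leXn XS.
have [->|/set0Pn[x xX]] := eqVneq X set0; first by rewrite setD0 cards0 addn0.
have cX := cardsD1 x X; rewrite xX in cX.
have /IHn IH : (#|X :\ x| < n)%N by lia.
have := IH (subset_trans (subsetDl _ _) XS).
have xS : x \in S :\: (X :\ x) by rewrite !inE eqxx (subsetP XS).
by have := m_geD1 xS; rewrite setDDl setUC setD1K //; lia.
Qed.

(** A path from [v] to [T] contributes a product of two factors. The bounds on the Wronskians are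
    carried along it and give order [n] for each: those for [z |: X] serve the factor inside [X],
    the one for [X :|: T] serves the other. *)
Lemma delta_dvdp (T X : {set V}) v n :
  v \notin X -> v \notin T -> [disjoint X & T] ->
  t ^+ n.*2.-1 %| wronskian (X :|: T) v ->
  (forall z, z \in T -> t ^+ n.*2.-1 %| wronskian (z |: X) v) ->
  t ^+ n.*2 %| delta X (X :|: T) v.
Proof.
have [k] := ubnP #|X|; elim: k X v => // k IHk X v; rewrite ltnS => leXk vX vT dXT WT Wz.
have TX z : z \in T -> z \notin X by move=> zT; rewrite (disjointFl dXT zT).
have vXT : v \notin X :|: T by rewrite inE negb_or vX.
rewrite deltaU_rec //; apply: dvdp_add.
  apply: dvdp_sum => y yX.
  have := w_ge0 v y; rewrite le0r => /predU1P[->|wvy]; first by rewrite scale0r dvdp0.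
  rewrite dvdpZr ?gt_eqF //.
  have yT : y \notin T by rewrite (disjointFr dXT yX).
  have E (Z : {set V}) : y \notin Z -> (X :|: Z) :\ y = X :\ y :|: Z.
    by move=> yZ; rewrite setDUl; congr (_ :|: _); apply/setDidPl; rewrite disjoint_sym disjoints1.
  apply: IHk => //.
  - by have := cardsD1 y X; rewrite yX; lia.
  - by rewrite !inE eqxx.
  - by apply: disjointWl dXT; rewrite subsetDl.
  - by rewrite -E //; apply: wronskian_dvdp_next WT; rewrite // inE yX.
  move=> z zT; have zy : y \notin [set z] by apply/set1P => yz; rewrite yz zT in yT.
  rewrite setUC -E // setUC; apply: wronskian_dvdp_next (Wz z zT) => //.
    by rewrite !inE (negPf vX) orbF; apply: contraNneq vT => ->.
  by rewrite !inE yX orbT.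
apply: dvdp_sum => y yT.
have := w_ge0 v y; rewrite le0r => /predU1P[->|wvy]; first by rewrite scale0r dvdp0.
rewrite dvdpZr ?gt_eqF // -addnn exprD; apply: dvdp_mul.
  have yX := TX y yT; apply: (wronskian_dvdp_base yX); rewrite -[X in wronskian X](setU1K yX).
  apply: wronskian_dvdp_next (Wz y yT) => //; last by rewrite setU11.
  by rewrite !inE (negPf vX) orbF; apply: contraNneq vT => ->.
have -> : X :|: (T :\ y) = (X :|: T) :\ y.
  by rewrite setDUl; congr (_ :|: _); apply/esym/setDidPl; rewrite disjoint_sym disjoints1 TX.
apply: (wronskian_dvdp_base (u := y)); first by rewrite !inE eqxx.
by apply: wronskian_dvdp_next WT; rewrite // inE yT orbT.
Qed.

Lemma delta_dvdpD2 S u v n : u \in S -> v \in S -> u != v ->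
  t ^+ n.*2.-1 %| wronskian (S :\ v) v ->
  t ^+ n.*2 %| mu (S :\ u) * mu (S :\ v) - mu (S :\ u :\ v) * mu S.
Proof.
move=> uS vS uv Wv; have uSv : u \in S :\ v by rewrite !inE uv.
have E : (S :\ u :\ v) :|: [set u] = S :\ v.
  apply/setP => z; rewrite !inE; have [->|//] := eqVneq z u; first by rewrite uv uS orbT.
  by rewrite orbF.
have -> : mu (S :\ u) * mu (S :\ v) - mu (S :\ u :\ v) * mu S
    = delta (S :\ u :\ v) (S :\ u :\ v :|: [set u]) v.
  by rewrite /delta E !setD1K // !inE eq_sym uv.
apply: delta_dvdp; rewrite ?E //.
- by rewrite !inE eqxx.
- by rewrite inE eq_sym.
- by rewrite disjoint_sym disjoints1 !inE eqxx andbF.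
by move=> z /set1P ->; rewrite setUC E.
Qed.

(** The order of [wronskian (S :\ v) v] is at least [2 * m S - 2], and the edge from [v] to [u]
    contributes a positive multiple of [mu (S :\ v :\ u) ^+ 2]. *)
Lemma adjacent_m S u v : u \in S -> v \in S -> u != v -> 0 < w v u ->
  (m S <= (m (S :\ v :\ u)).+1)%N.
Proof.
move=> uS vS uv wvu; suff: ((m S).-1 <= m (S :\ v :\ u))%N by lia.
rewrite m_geq; apply: (wronskian_dvdp_base (u := u)); first by rewrite !inE eqxx.
apply: (@wronskian_dvdp_next _ v) => //; rewrite ?inE ?eqxx ?uv //.
apply: dvdp_trans (wronskian_dvdp (a := (m S).-1) (b := m S) _ _); rewrite -?m_geq ?setD1K //.
  by rewrite dvdp_exp2l //; lia.
by have := m_leD1 vS; lia.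
Qed.

(** If [m (S :\ v) = m S], the Wronskian gives order [m S] for [mu (S :\ u :\ v)], and then
    [delta_dvdpD2] gives order [2 * m S] for [mu (S :\ u) * mu (S :\ v)], whose order is one
    less. *)
Lemma essential_neighbor S u v : u \in S -> v \in S -> u != v -> 0 < w v u ->
  m S = (m (S :\ u)).+1 -> m (S :\ v) != m S.
Proof.
move=> uS vS uv wvu mu_ess; apply/eqP => mv.
have Wv : t ^+ (m S).*2.-1 %| wronskian (S :\ v) v.
  by rewrite -addnn; apply: wronskian_dvdp; rewrite -m_geq ?setD1K // mv.
have tuv : t ^+ m S %| mu (S :\ u :\ v).
  rewrite setDDl setUC -setDDl.
  apply: (wronskian_dvdp_base (u := u)); first by rewrite !inE eqxx.
  by apply: (@wronskian_dvdp_next _ v) => //; rewrite ?inE ?eqxx ?uv.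
have := delta_dvdpD2 uS vS uv Wv; rewrite dvdp_subl; last first.
  by rewrite -addnn exprD dvdp_mul // -m_geq.
rewrite -mup_geq ?mulf_neq0 ?mu_neq0 // mupM ?mu_neq0 // -!/(m _) mv mu_ess; lia.
Qed.

(* Transitivity comes from [delta] with a two-element symmetric difference
   [[set u; x]]: all path terms vanish to order [2 (m S - 1)], while
   [mu (S :\ u :\ x) * mu (S :\ v)] would only vanish to order [2 (m S) - 3]. *)
Lemma nonessential_pair_trans S u v x :
  u \in S -> v \in S -> x \in S -> u != v -> u != x -> v != x ->
  m S = (m (S :\ u)).+1 -> m S = (m (S :\ v)).+1 -> m S = (m (S :\ x)).+1 ->
  (m S <= (m (S :\ u :\ v)).+1)%N -> (m S <= (m (S :\ x :\ v)).+1)%N ->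
  (m S <= (m (S :\ u :\ x)).+1)%N.
Proof.
move=> uS vS xS uv ux vx eu ev ex muv mxv.
have [n mS] : exists n, m S = n.+1 by exists (m (S :\ u)).
move: eu ev ex muv mxv; rewrite mS !ltnS => -[eu] [ev] [ex] muv mxv.
pose X := S :\ u :\ x :\ v.
have EU : X :|: [set u; x] = S :\ v.
  apply/setP => z; rewrite !inE; have [->|zu] := eqVneq z u; first by rewrite uv uS orbT.
  by have [->|zx] := eqVneq z x; rewrite ?orbT ?orbF //= eq_sym vx xS.
have EX : v |: X = S :\ u :\ x by rewrite setD1K // !inE vx eq_sym uv.
have Eu : u |: X = S :\ x :\ v.
  apply/setP => z; rewrite !inE; have [->|zu] := eqVneq z u; first by rewrite uv uS ux.
  by rewrite andbCA.
have Ex : x |: X = S :\ u :\ v.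
  apply/setP => z; rewrite !inE; have [->|zu] := eqVneq z x.
    by rewrite xS eq_sym vx eq_sym ux.
  by rewrite andTb.
have v_ux : v \notin [set u; x] by rewrite !inE negb_or eq_sym uv vx.
have dX : [disjoint X & [set u; x]].
  rewrite -setI_eq0; apply/eqP/setP => z; rewrite !inE.
  by case: (z == u); case: (z == x); rewrite ?andbF.
have Wuv : t ^+ n.*2.-1 %| wronskian (S :\ v) v.
  apply: dvdp_trans (wronskian_dvdp (a := n) (b := n.+1) _ _).
  - by rewrite dvdp_exp2l // addnS /= addnn leq_pred.
  - by rewrite -m_geq -ev.
  by rewrite setD1K // -m_geq mS.
have Wz z : z \in [set u; x] -> t ^+ n.*2.-1 %| wronskian (z |: X) v.
  move=> zux; rewrite -addnn; apply: wronskian_dvdp; rewrite -m_geq; move: zux => /set2P[] ->.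
  - by rewrite Eu.
  - by rewrite Ex.
  - by rewrite Eu setD1K ?inE ?vx ?vS // -ex.
  by rewrite Ex setD1K ?inE 1?eq_sym ?uv ?vS // -eu.
have vX : v \notin X by rewrite !inE eqxx.
have := delta_dvdp vX v_ux dX; rewrite EU => /(_ _ Wuv Wz).
rewrite /delta EX dvdp_subl; last first.
  have mX : (n <= (m X).+1)%N.
    apply: leq_trans muv _; have -> : X = S :\ u :\ v :\ x.
      by rewrite /X setDDl [[set x] :|: _]setUC -setDDl.
    by apply: m_leD1; rewrite !inE eq_sym vx eq_sym ux.
  apply: dvdp_trans (dvdp_mul (d1 := t ^+ n.-1) (d2 := t ^+ n.+1) _ _).
  - by rewrite -exprD dvdp_exp2l // addnS -addnn; case: (n).
  - by rewrite -m_geq; case: (n) mX.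
  by rewrite setD1K // -m_geq mS.
by rewrite -mup_geq ?mulf_neq0 ?mu_neq0 // mupM ?mu_neq0 // -!/(m _) -ev -addnn leq_add2r.
Qed.

(** * Critical sets and the analogue of Gallai's lemma *)

Definition critical K := K != set0 /\ forall v, v \in K -> m K = (m (K :\ v)).+1.

(** Otherwise the derivative, the sum of the [mu (S :\ v)], would vanish to the full order [m S]. *)
Lemma essential_exists S : (0 < m S)%N -> exists2 v, v \in S & m S = (m (S :\ v)).+1.
Proof.
move=> mS; suff /exists_inP[v vS /eqP] : [exists v in S, m S == (m (S :\ v)).+1] by exists v.
apply: contraT; rewrite negb_exists_in => /forall_inP H.
case: (posnP (m S)) mS => // mS _.
have := @mup_deriv_ndvdp R theta (mu S) (m S).-1 (mu_neq0 S).
rewrite prednK // => /(_ erefl) /negP[].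
rewrite deriv_mu; apply: dvdp_sum => y yS.
by rewrite -m_geq; have := m_leD1 yS; rewrite leq_eqVlt (negPf (H y yS)).
Qed.

(** By [essential_neighbor] and the last hypothesis, the vertices whose deletion lowers [m] are
    closed under adjacency. *)
Lemma no_positive_essential K : linked e K -> (0 < m K)%N ->
  (forall v, v \in K -> (m (K :\ v) <= m K)%N) -> critical K.
Proof.
move=> lK mK npos; have [u uK eu] := essential_exists mK.
have KE : [set v in K | m K == (m (K :\ v)).+1] = K.
  apply: lK => [| |x y]; first by apply/subsetP => v; rewrite inE => /andP[].
    by apply/set0Pn; exists u; rewrite inE uK eu eqxx.
  rewrite !inE => /andP[xK /eqP ex] yK wxy; rewrite yK /=.
  have [xy|xy] := eqVneq x y; first by rewrite -xy ex.
  have := essential_neighbor xK yK xy; rewrite w_sym => /(_ wxy ex) my.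
  by rewrite eqn_leq m_leD1 // ltn_neqAle my npos.
split=> [|v]; first by apply/set0Pn; exists u.
by rewrite -{1}KE inE => /andP[_ /eqP].
Qed.

(** Deleting a pair of vertices lowers [m] by at most one for neighbors ([adjacent_m]), and this
    relation is transitive ([nonessential_pair_trans]), so it holds for all pairs. Hence no vertex
    lowers [m] in [K :\ u], and [m (K :\ u) = 0]. *)
Lemma critical_simple K : linked e K -> critical K -> m K = 1%N.
Proof.
move=> lK [/set0Pn[u uK] ess].
have KE : [set v in K | (v == u) || (m K <= (m (K :\ u :\ v)).+1)%N] = K.
  apply: lK => [| |x y]; first by apply/subsetP => v; rewrite inE => /andP[].
    by apply/set0Pn; exists u; rewrite inE uK eqxx.
  rewrite !inE => /andP[xK Hx] yK wxy; rewrite yK /=.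
  have [//|yu] := eqVneq y u.
  have [xu|xu] := eqVneq x u.
    by rewrite -xu; apply: adjacent_m; rewrite // xu.
  rewrite (negPf xu) /= in Hx; have [<-//|xy] := eqVneq x y.
  apply: (@nonessential_pair_trans _ _ x); rewrite 1?eq_sym //; do ?exact: ess.
  - by rewrite eq_sym.
  by apply: adjacent_m; rewrite // w_sym.
rewrite (ess u uK); congr S; apply/eqP; rewrite -leqn0 leqNgt; apply/negP => /essential_exists[v].
rewrite !inE => /andP[vu vK] mv.
move: vK; rewrite -KE inE (negPf vu) /= => /andP[_].
by rewrite (ess u uK) mv ltnn.
Qed.

(** * Signs of leading coefficients and putting vertices back *)

Definition lead_at S := (mu S %/ t ^+ m S).[theta].

Lemma muE S : mu S = (mu S %/ t ^+ m S) * t ^+ m S.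
Proof. by rewrite divpK // -m_geq. Qed.

Lemma lead_at_neq0 S : lead_at S != 0.
Proof.
rewrite /lead_at -rootE -dvdp_XsubCl; apply/negP => t_dvd.
have : ((m S).+1 <= m S)%N.
  by rewrite m_geq [X in _ %| X]muE exprS dvdp_mul2r // expf_neq0 // polyXsubC_eq0.
by rewrite ltnn.
Qed.

Lemma mu_theta_eq0 S : ((mu S).[theta] == 0) = (0 < m S)%N.
Proof. by rewrite m_geq expr1 dvdp_XsubCl rootE. Qed.

(** The coefficient of order [2 * m (S :\ d)] of the Wronskian at [theta] is the product of both
    leading coefficients, and a sum of squares makes it nonnegative. *)
Lemma lead_at_sign S d : d \in S -> m S = (m (S :\ d)).+1 -> 0 < lead_at S * lead_at (S :\ d).
Proof.
move=> dS ed; rewrite lt0r mulf_neq0 ?lead_at_neq0 //=.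
have dSd : d \notin S :\ d by rewrite !inE eqxx.
have := wronskian_sos dSd; rewrite /wronskian setD1K // (muE S) (muE (S :\ d)) /lead_at.
rewrite {}ed; set n := m (S :\ d); set P := mu S %/ _; set Q := mu (S :\ d) %/ _ => W.
rewrite mulrC.
suff /sos_divX : sos (t ^+ n.*2 * (Q * P + t * (Q * P^`() - P * Q^`()))).
  by rewrite !hornerE subrr mul0r addr0.
move: W; congr sos; rewrite !derivM !deriv_exp derivXsubC /= mul1r.
exact: wronskian_expX.
Qed.

Lemma mu_vanish Q Z : [disjoint Q & Z] -> (#|Z| < m Q)%N -> (mu (Q :|: Z)).[theta] = 0.
Proof.
move=> dQZ ltZ; apply/eqP; rewrite mu_theta_eq0.
have := m_geD (subsetUr Q Z).
rewrite setDUl setDv setU0 (setDidPl _) //; lia.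
Qed.

(** The linear term and the terms with [y] in [Z] drop out: they add fewer than [m Q] vertices to
    [Q], too few to remove its zero. *)
Lemma horner_muU1 Q Z a : a \notin Q -> a \notin Z -> [disjoint Q & Z] -> m Q = #|Z|.+1 ->
  (mu (a |: (Q :|: Z))).[theta] = - \sum_(y in Q) w a y * (mu ((Q :\ y) :|: Z)).[theta].
Proof.
move=> aQ aZ dQZ mQ; rewrite muU1; last by rewrite inE negb_or aQ.
rewrite !hornerE mu_vanish ?mQ // mulr0 add0r horner_sum; congr (- _).
rewrite (big_setID Q) /= [X in _ + X]big1 ?addr0.
  rewrite (setIidPr _) ?subsetUl //; apply: eq_bigr => y yQ; rewrite hornerZ.
  congr (_ * (mu _).[_]); apply/setP => z; rewrite !inE; case: eqP => [->|//].
  by rewrite (disjointFr dQZ yQ).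
move=> y; rewrite !inE => /andP[yQ]; rewrite (negPf yQ) /= => yZ.
rewrite hornerZ (_ : _ :\ y = Q :|: Z :\ y) ?mu_vanish ?mulr0 //.
- by apply: disjointWr dQZ; rewrite subsetDl.
- by rewrite mQ; have := cardsD1 y Z; rewrite yZ; lia.
by apply/setP => z; rewrite !inE; case: eqP => [->|//]; rewrite (negPf yQ).
Qed.

Lemma augment_term_ge0 Q Z :
  (forall Q', [disjoint Q' & Z] -> m Q' = #|Z| ->
     0 <= (-1) ^+ #|Z| * lead_at Q' * (mu (Q' :|: Z)).[theta]) ->
  [disjoint Q & Z] -> m Q = #|Z|.+1 ->
  forall y, y \in Q -> 0 <= (-1) ^+ #|Z| * lead_at Q * (mu ((Q :\ y) :|: Z)).[theta].
Proof.
move=> IH dQZ mQ y yQ.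
have dQyZ : [disjoint Q :\ y & Z] by apply: disjointWl dQZ; rewrite subsetDl.
(* Either [Q :\ y] keeps a zero that [Z] cannot remove, and the value is 0, or its multiplicity is
   exactly [#|Z|]. *)
have [ltm|] := ltnP #|Z| (m (Q :\ y)); first by rewrite mu_vanish // mulr0.
have := m_leD1 yQ; rewrite mQ ltnS => le1 le2.
have my : m (Q :\ y) = #|Z| by apply/eqP; rewrite eqn_leq le1 le2.
have := lead_at_sign yQ; rewrite my mQ => /(_ erefl).
have := IH _ dQyZ my; set c := lead_at Q; set c' := lead_at _; set s := (-1) ^+ _; set v := _.[_].
move=> ge0 gt0; have c'0 : 0 < c' ^+ 2 by rewrite exprn_even_gt0 //= lead_at_neq0.
(* The positive factor [c' ^+ 2] allows [lead_at Q] to be traded for [lead_at (Q :\ y)], which has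
   the same sign. *)
rewrite -(pmulr_lge0 _ c'0).
have -> : s * c * v * c' ^+ 2 = (s * c' * v) * (c * c').
  by clearbody s c v c'; ring.
by rewrite mulr_ge0 // ltW.
Qed.

(* Deleting a vertex that lowers the multiplicity preserves the sign of the
   leading coefficient at [theta], so no cancellation occurs in [horner_muU1]. *)
Lemma augment_ge0 Q Z : [disjoint Q & Z] -> m Q = #|Z| ->
  0 <= (-1) ^+ #|Z| * lead_at Q * (mu (Q :|: Z)).[theta].
Proof.
have [n] := ubnP #|Z|; elim: n Q Z => // n IHn Q Z; rewrite ltnS => leZn dQZ mQ.
have [Z0|/set0Pn[a aZ]] := eqVneq Z set0.
  move: mQ; rewrite Z0 cards0 setU0 expr0 mul1r /lead_at => ->.
  by rewrite expr0 divp1 -expr2 sqr_ge0.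
have cZ := cardsD1 a Z; rewrite aZ add1n in cZ.
have ZE : Q :|: Z = a |: (Q :|: Z :\ a) by rewrite setUCA setD1K.
have dQZa : [disjoint Q & Z :\ a] by apply: disjointWr dQZ; rewrite subsetDl.
rewrite ZE horner_muU1 //; [|by rewrite (disjointFl dQZ aZ)|by rewrite !inE eqxx|by rewrite mQ].
rewrite cZ exprS mulrN mulN1r !mulNr opprK mulr_sumr sumr_ge0 // => y yQ.
rewrite mulrCA mulr_ge0 //; apply: augment_term_ge0 yQ => //; last by rewrite mQ.
by move=> Q' dQ'; apply: IHn => //; lia.
Qed.

(** [s] matches the added vertices with distinct vertices of [Q]. In [horner_muU1] for [a] the term
    of its partner [d] is nonzero by induction, and all terms have the same sign. *)
Lemma augment_neq0 Q (s : seq (V * V)) :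
  uniq (unzip1 s) -> uniq (unzip2 s) -> [disjoint Q & [set a in unzip1 s]] ->
  {subset unzip2 s <= Q} -> (forall p, p \in s -> 0 < w p.1 p.2) -> m Q = size s ->
  (mu (Q :\: [set d in unzip2 s])).[theta] != 0 ->
  (mu (Q :|: [set a in unzip1 s])).[theta] != 0.
Proof.
move=> u1 u2 dQ sub pos mQ nz.
suff: 0 < (-1) ^+ size s * lead_at Q * (mu (Q :|: [set a in unzip1 s])).[theta].
  by apply: contraTneq => ->; rewrite mulr0 ltxx.
elim: s Q u1 u2 dQ sub pos mQ nz => [|[a d] s IHs] Q /=.
  move=> _ _ _ _ _ mQ; rewrite expr0 mul1r /lead_at mQ expr0 divp1 => nz.
  rewrite (_ : [set a in _] = set0) ?setU0; last by apply/setP => z; rewrite !inE.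
  rewrite -expr2 exprn_even_gt0 //=; move: nz.
  by rewrite (_ : [set d in _] = set0) ?setD0 //; apply/setP => z; rewrite !inE.
move=> /andP[a_s u1] /andP[d_s u2] dQ sub pos mQ nz.
set Z := [set a in unzip1 s].
have cZ : #|Z| = size s by rewrite cardsE (card_uniqP u1) size_map.
have ZE : [set x in a :: unzip1 s] = a |: Z by apply/setP => z; rewrite !inE.
have DE : [set x in d :: unzip2 s] = d |: [set x in unzip2 s] by apply/setP => z; rewrite !inE.
rewrite ZE in dQ *; rewrite DE -setDDl in nz.
have dQ_Z : [disjoint Q & Z] by apply: disjointWr dQ; rewrite subsetUr.
have aQ : a \notin Q by rewrite (disjointFl dQ (setU11 _ _)).
have aZ : a \notin Z by rewrite inE.
have dInQ : d \in Q by apply: sub; rewrite mem_head.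
have subd : {subset unzip2 s <= Q :\ d}.
  move=> z zs; rewrite !inE sub ?inE ?zs ?orbT // andbT.
  by apply: contraNneq d_s => <-.
(* The lower bound is interlacing; the upper one holds because deleting the [size s] remaining
   partners leaves multiplicity 0. *)
have md : m (Q :\ d) = size s.
  apply/eqP; rewrite eqn_leq; apply/andP; split; last by rewrite -ltnS -mQ m_leD1.
  have := @m_leD (Q :\ d) [set x in unzip2 s].
  rewrite cardsE (card_uniqP u2) size_map.
  have -> : m (Q :\ d :\: [set x in unzip2 s]) = 0%N.
    by apply/eqP; rewrite -leqn0 leqNgt -mu_theta_eq0.
  by apply; apply/subsetP => z; rewrite inE => /subd.
have dQdZ : [disjoint Q :\ d & Z] by apply: disjointWl dQ_Z; rewrite subsetDl.
have pos' p : p \in s -> 0 < w p.1 p.2 by move=> ps; apply: pos; rewrite inE ps orbT.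
have gt0 := IHs _ u1 u2 dQdZ subd pos' md nz.
rewrite -/Z in gt0.
rewrite setUCA horner_muU1 // ?cZ //.
rewrite exprS mulrN mulN1r !mulNr opprK mulr_sumr (bigD1 d) //=.
have term_ge0 y : y \in Q -> 0 <= (-1) ^+ size s * lead_at Q * (mu ((Q :\ y) :|: Z)).[theta].
  rewrite -cZ; apply: augment_term_ge0 => //; last by rewrite cZ.
  by move=> Q'; apply: augment_ge0.
apply: ltr_wpDr.
  by apply: sumr_ge0 => y /andP[yQ _]; rewrite mulrCA mulr_ge0 // term_ge0.
rewrite mulrCA mulr_gt0 //; first by have := pos (a, d); apply; rewrite mem_head.
rewrite lt0r term_ge0 // andbT !mulf_neq0 ?expf_neq0 ?lead_at_neq0 ?oppr_eq0 ?oner_eq0 //.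
by move: gt0; apply: contraTneq => ->; rewrite mulr0 ltxx.
Qed.

(** * Consequences of the absence of good cycles *)

Hypothesis w_diag : forall v, w v v = 0.

(** Here the order is known path by path. As [T] is the single vertex [u], both factors of a path
    term are [mu] of [X] minus the path. *)
Lemma delta_dvdp_path X u v n : u \notin X -> v \notin X -> v != u ->
  (forall p, path e v (rcons p u) -> uniq p -> {subset p <= X} ->
     t ^+ n %| mu (X :\: [set x in p])) ->
  t ^+ n.*2 %| delta X (X :|: [set u]) v.
Proof.
have [k] := ubnP #|X|; elim: k X v => // k IHk X v; rewrite ltnS => leXk uX vX vu H.
rewrite deltaU_rec //; [|by rewrite inE|by rewrite disjoint_sym disjoints1].
rewrite big_set1 setDv setU0; apply: dvdp_add; last first.
  have := w_ge0 v u; rewrite le0r => /predU1P[->|wvu]; first by rewrite scale0r dvdp0.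
  rewrite dvdpZr ?gt_eqF // -addnn exprD dvdp_mul //;
    have := H [::]; rewrite (_ : [set x in _] = set0) ?setD0 /= ?andbT;
    by [apply | apply/setP => z; rewrite !inE].
apply: dvdp_sum => y yX.
have := w_ge0 v y; rewrite le0r => /predU1P[->|wvy]; first by rewrite scale0r dvdp0.
rewrite dvdpZr ?gt_eqF //; apply: IHk.
- by have := cardsD1 y X; rewrite yX; lia.
- by rewrite !inE (negPf uX) andbF.
- by rewrite !inE eqxx.
- by apply: contraNneq uX => <-.
move=> p py up sub; have := H (y :: p).
rewrite (_ : [set x in _] = y |: [set x in p]); last by apply/setP => z; rewrite !inE.
rewrite -setDDl; apply.
- by rewrite /= py andbT.
- by rewrite /= up andbT; apply/negP => /sub; rewrite !inE eqxx.
by move=> z; rewrite inE => /predU1P[->//|/sub]; rewrite inE => /andP[].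
Qed.

(* Cycles of length at least 3 in the simple graph of positive weights; loops and
   parallel edges are treated separately. *)
Definition no_good_cycle K := forall c : seq V, (2 < size c)%N -> uniq c ->
  {subset c <= K} -> cycle e c -> (0 < m (K :\: [set x in c]))%N.

(** The edge itself gives the square that is subtracted. Every other path from [v] to [u] closes up
    with this edge to a cycle of length at least 3, so both factors of its term vanish at
    [theta]. *)
Lemma no_good_cycle_delta K u v : no_good_cycle K -> u \in K -> v \in K -> e u v ->
  t ^+ 2 %| mu (K :\ u) * mu (K :\ v) - mu (K :\ u :\ v) * mu K
            - w u v *: mu (K :\ u :\ v) ^+ 2.
Proof.
move=> ngK uK vK euv; have uv : u != v by apply: contraTneq euv => ->; rewrite /e w_diag ltxx.
pose X := K :\ u :\ v.
have uX : u \notin X by rewrite !inE eqxx andbF.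
have vX : v \notin X by rewrite !inE eqxx.
have EU : X :|: [set u] = K :\ v.
  apply/setP => z; rewrite !inE; have [->|//] := eqVneq z u; first by rewrite uv uK orbT.
  by rewrite orbF.
have EX : v |: X = K :\ u by rewrite setD1K // !inE vK eq_sym uv.
have -> : mu (K :\ u) * mu (K :\ v) - mu X * mu K = delta X (X :|: [set u]) v.
  by rewrite /delta EU EX setD1K.
rewrite deltaU_rec //; [|by rewrite inE eq_sym|by rewrite disjoint_sym disjoints1].
rewrite big_set1 setDv setU0 w_sym -expr2 addrK.
apply: dvdp_sum => y yX.
have := w_ge0 v y; rewrite le0r => /predU1P[->|wvy]; first by rewrite scale0r dvdp0.
rewrite dvdpZr ?gt_eqF //; apply: (@delta_dvdp_path _ _ _ 1).
- by rewrite !inE eqxx !andbF.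
- by rewrite !inE eqxx.
- by apply: contraNneq uX => <-.
move=> p py up sub; rewrite expr1.
have yK : y \in K by move: yX; rewrite !inE => /and3P[].
have yp : y \notin p by apply/negP => /sub; rewrite !inE eqxx.
have := ngK [:: u, v, y & p]; rewrite m_geq expr1.
rewrite (_ : K :\: _ = X :\ y :\: [set x in p]); last first.
  apply/setP => z; rewrite !inE.
  by case: (z == u); case: (z == v); case: (z == y); rewrite ?andbF.
apply => //=.
- rewrite yp up !inE !negb_or uv /= ?andbT -!andbA; apply/and4P; split=> //.
  + by apply: contraNneq uX => ->.
  + by apply/negP => /sub; rewrite !inE eqxx !andbF.
  + by apply: contraNneq vX => ->.
  + by apply/negP => /sub; rewrite !inE eqxx !andbF.
- move=> z; rewrite !inE => /or4P[/eqP->//|/eqP->//|/eqP->//|/sub].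
  by rewrite !inE => /and4P[].
by apply/and3P.
Qed.

Lemma dvdp_sqr_horner (f : {poly R}) : t ^+ 2 %| f -> f.[theta] = 0 /\ f^`().[theta] = 0.
Proof.
move=> t2; split; apply/rootP; rewrite -dvdp_XsubCl.
  by apply: dvdp_trans t2; rewrite expr2 dvdp_mulr.
exact: exp_dvdp_deriv t2.
Qed.

Lemma no_good_cycle_edge K u v : no_good_cycle K -> m K = 1%N -> critical K ->
  u \in K -> v \in K -> e u v ->
  (mu (K :\ u)).[theta] * (mu (K :\ v)).[theta]
    = w u v * (mu (K :\ u :\ v)).[theta] ^+ 2.
Proof.
move=> ngK mK [_ ess] uK vK euv.
have [] := dvdp_sqr_horner (no_good_cycle_delta ngK uK vK euv).
have muK : (mu K).[theta] = 0 by apply/eqP; rewrite mu_theta_eq0 mK.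
by rewrite !hornerE muK mulr0 subr0 => /eqP; rewrite subr_eq0 => /eqP.
Qed.

(* With [G v y] as below, the derivative of the vertex recursion at [theta] reads
   [D = a v + \sum_y G v y], and [no_good_cycle_delta] gives [G v y + G y v = D] on
   each edge. Since [D = \sum_v a v], summing over [v] yields [|K| = 1 + |E|]. *)
Lemma no_good_cycle_count K : no_good_cycle K -> m K = 1%N -> critical K ->
  (#|arcs e K|.+2 = 2 * #|K|)%N.
Proof.
move=> ngK mK critK; have ess := critK.2.
pose a v := (mu (K :\ v)).[theta]; pose a' v := (mu (K :\ v))^`().[theta].
pose b u v := (mu (K :\ u :\ v)).[theta]; pose b' u v := (mu (K :\ u :\ v))^`().[theta].
pose D := (mu K)^`().[theta].
have muK : (mu K).[theta] = 0 by apply/eqP; rewrite mu_theta_eq0 mK.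
have a0 v : v \in K -> a v != 0.
  by move=> vK; rewrite /a mu_theta_eq0 -leqNgt -ltnS -(ess v vK) mK.
have D0 : D != 0.
  have := mup_deriv_ndvdp (mu_neq0 K) mK.
  by rewrite expr1 dvdp_XsubCl.
have bC u v : b u v = b v u by rewrite /b setDDl setUC -setDDl.
have b'C u v : b' u v = b' v u by rewrite /b' setDDl setUC -setDDl.
have sumD : D = \sum_(v in K) a v by rewrite /D deriv_mu horner_sum.
(* Eliminating [theta - r v] between the vertex recursion and its derivative leaves this
   contribution of [y] to [D]. *)
pose G v y := w v y * (b v y * a' v / a v - b' v y).
have vertex v : v \in K -> D = a v + \sum_(y in K | e v y) G v y.
  move=> vK; have vertex0 : (theta - r v) * a v = \sum_(y in K :\ v) w v y * b v y.
    apply/eqP; rewrite -subr_eq0; move/eqP: muK; rewrite (muD1 vK) !hornerE horner_sum.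
    by under eq_bigr do rewrite hornerZ.
  have vertex1 : D = a v + (theta - r v) * a' v - \sum_(y in K :\ v) w v y * b' v y.
    rewrite /D (muD1 vK) derivB derivM derivXsubC deriv_sum !hornerE horner_sum.
    by under eq_bigr do rewrite derivZ hornerZ.
  have -> : \sum_(y in K | e v y) G v y = \sum_(y in K :\ v) G v y.
    rewrite big_mkcondr (big_setD1 v) //= /e w_diag ltxx add0r; apply: eq_bigr => y _.
    have := w_ge0 v y; rewrite le0r /G => /predU1P[->|->//]; by rewrite mul0r if_same.
  rewrite /G; under eq_bigr do rewrite mulrBr.
  rewrite sumrB addrA vertex1; congr (_ + _ - _).
  apply: (mulIf (a0 v vK)); rewrite mulrAC vertex0 !mulr_suml; apply: eq_bigr => y _.
  by rewrite !mulrA divfK ?a0 // mulrA.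
have edge v y : v \in K -> y \in K -> e v y -> G v y + G y v = D.
  move=> vK yK evy; have [E0 E1] := dvdp_sqr_horner (no_good_cycle_delta ngK vK yK evy).
  have ab := no_good_cycle_edge ngK mK critK vK yK evy.
  move: E1; rewrite !(derivB, derivM, derivZ, deriv_exp) !hornerE muK /=.
  rewrite -!/(a _) -!/(a' _) -!/(b _ _) -!/(b' _ _) -!/D in ab *.
  rewrite /G [b y v]bC [b' y v]b'C [w y v]w_sym.
  have := a0 v vK; have := a0 y yK.
  move: (a v) (a y) (a' v) (a' y) (b v y) (b' v y) (w v y) ab => i j x z c c' ww.
  move=> ij j0 i0 E1.
  have b0 : ww * c ^+ 2 != 0 by rewrite -ij mulf_neq0.
  have c0 : c != 0 by apply: contraNneq b0 => ->; rewrite expr0n mulr0.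
  have ww0 : ww != 0 by apply: contraNneq b0 => ->; rewrite mul0r.
  have E2 : x * j + i * z = c * D + ww * (c' * c + c * c') by apply/subr0_eq; rewrite -E1; ring.
  have -> : ww * (c * x / i - c') + ww * (c * z / j - c')
      = ww * c * ((x * j + i * z) / (i * j)) - ww * c' - ww * c'.
    by field; rewrite i0 j0.
  by rewrite E2 ij; field; rewrite c0 ww0.
have sumG : (\sum_(v in K) \sum_(y in K | e v y) G v y) *+ 2 = D *+ #|arcs e K|.
  have sumGC : \sum_(v in K) \sum_(y in K | e v y) G v y
      = \sum_(v in K) \sum_(y in K | e v y) G y v.
    rewrite (exchange_big_dep (mem K)) /=; last by move=> v y _ /andP[].
    apply: eq_bigr => v vK; apply: eq_bigl => y.
    by rewrite vK /e w_sym; case: (y \in K).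
  rewrite mulr2n {2}sumGC -big_split /= -sumr_const.
  transitivity (\sum_(v in K) \sum_(y in K | e v y) D).
    apply: eq_bigr => v vK; rewrite -big_split /=; apply: eq_bigr => y /andP[yK evy].
    exact: edge.
  by rewrite pair_big_dep /=; apply: eq_bigl => p; rewrite inE.
have : (2 * #|K|)%:R * D = (#|arcs e K|.+2)%:R * D.
  have sumDK : \sum_(v in K) D = D + \sum_(v in K) \sum_(y in K | e v y) G v y.
    by rewrite {2}sumD -big_split; apply: eq_bigr => v vK; apply: vertex.
  by rewrite !mulr_natl mulnC mulrnA -sumr_const sumDK mulrnDl sumG -mulrnDr.
by move/(mulIf D0)/eqP; rewrite eqr_nat => /eqP.
Qed.

(** * Components and barriers *)

Lemma weight_sym : symmetric e.
Proof. by move=> x y; rewrite /e w_sym. Qed.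

Lemma weight_irr : irreflexive e.
Proof. by move=> x; rewrite /e w_diag ltxx. Qed.

Lemma w_eq0 u v : ~~ e u v -> w u v = 0.
Proof. by rewrite /e -leNgt => wle0; apply: le_anti; rewrite wle0 w_ge0. Qed.

Lemma m_setU S X : [disjoint S & X] ->
  (forall u v, u \in S -> v \in X -> ~~ e u v) -> m (S :|: X) = (m S + m X)%N.
Proof.
move=> dSX neSX; rewrite /m muU ?mupM ?mu_neq0 // => u v uS vX.
by apply: w_eq0; apply: neSX.
Qed.

Lemma m_set0 : m set0 = 0%N.
Proof.
by apply/eqP; rewrite -leqn0 /m mu0 mup_leq ?oner_neq0 // expr1 dvdp1 size_XsubC.
Qed.

(** Intersecting with [X] accounts for deletions while keeping the original blocks, even where
    [K :&: X] is no longer connected. *)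
Lemma m_blocks P S X : blocks e P S -> m (S :&: X) = (\sum_(K in P) m (K :&: X))%N.
Proof.
have [n] := ubnP #|P|; elim: n P S => // n IHn P S; rewrite ltnS => leP bP.
have [/and3P[/eqP covP trivP P0] lP cP] := bP.
have [PE|/set0Pn[K KP]] := eqVneq P set0.
  by rewrite -covP PE /cover !big_set0 set0I m_set0.
have cPK := cardsD1 K P; rewrite KP in cPK.
rewrite (big_setD1 K) //= -(IHn _ (cover (P :\ K)));
  last by apply: blocks_cover bP _; rewrite subsetDl.
  have -> : S :&: X = (K :&: X) :|: (cover (P :\ K) :&: X).
    by rewrite -setIUl -covP /cover (big_setD1 K).
  have dK : [disjoint K & cover (P :\ K)].
    rewrite disjoint_sym -setI_eq0; apply/eqP/setP => z; rewrite !inE.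
    apply/negP => /andP[/bigcupP[K' /setD1P[K'K K'P] zK'] zK].
    have /trivIsetP/(_ K' K K'P KP K'K) := trivP.
    by move/disjoint_setI0/setP/(_ z); rewrite !inE zK zK'.
  apply: m_setU.
    by apply: disjointWl (disjointWr _ dK); rewrite subsetIl.
  move=> u v /setIP[uK _] /setIP[vC _]; apply/negP => euv.
  have vS : v \in S.
    case/bigcupP: vC => K' /setD1P[_ K'P] vK'.
    by rewrite -covP; apply/bigcupP; exists K'.
  by have := cP K u v KP uK vS euv; rewrite (disjointFl dK vC).
by lia.
Qed.

Lemma m_blocks_sum P S : blocks e P S -> m S = (\sum_(K in P) m K)%N.
Proof.
move=> bP; rewrite -[S]setIT (m_blocks _ bP).
by apply: eq_bigr => K _; rewrite setIT.
Qed.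

(** The counterpart of a Tutte barrier: by [m_geD], deleting [#|A|] vertices cannot raise [m] by
    more. *)
Definition barrier S A := (A \subset S) && (m (S :\: A) == m S + #|A|)%N.

Lemma maximal_barrier S : exists2 A, barrier S A &
  forall v, v \in S :\: A -> (m (S :\: A :\ v) <= m (S :\: A))%N.
Proof.
have bar0 : barrier S set0 by rewrite /barrier sub0set setD0 cards0 addn0 eqxx.
case: (arg_maxnP (fun A : {set V} => #|A|) bar0) => A bA Amax; exists A => // v vA.
rewrite leqNgt; apply/negP => ltm; have /andP[AS /eqP mA] := bA.
have /andP[vnA vS] : (v \notin A) && (v \in S) by rewrite inE in vA.
have /Amax : barrier S (v |: A).
  rewrite /barrier subUset sub1set vS AS /= setUC -setDDl.
  apply/eqP/anti_leq; rewrite [#|_|]cardsU disjoint_setI0 1?disjoint_sym ?disjoints1 //.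
  rewrite cards1 cards0; have := m_geD1 vA; rewrite mA in ltm *; lia.
by rewrite cardsU1 vnA; lia.
Qed.

Lemma barrier_block_critical S A P K : barrier S A ->
  (forall v, v \in S :\: A -> (m (S :\: A :\ v) <= m (S :\: A))%N) ->
  blocks e P (S :\: A) -> K \in P -> (0 < m K)%N -> critical K /\ m K = 1%N.
Proof.
move=> bA npos bP KP mK; have [/and3P[/eqP covP trivP P0] lP cP] := bP.
have KB : K \subset S :\: A by rewrite -covP; apply: (bigcup_max K).
have cK : critical K.
  apply: no_positive_essential => //; first exact: lP.
  move=> v vK; have vB := subsetP KB v vK; have := npos v vB.
  rewrite setDE (m_blocks _ bP) (m_blocks_sum bP) (big_setD1 K) //=.
  rewrite [X in (_ <= X)%N -> _](big_setD1 K) //=.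
  rewrite [X in (_ + X <= _)%N](eq_bigr m) ?leq_add2r -?setDE // => K' /setD1P[K'K K'P].
  congr m; apply/setIidPl; rewrite -disjoints_subset disjoint_sym disjoints1.
  have /trivIsetP/(_ K' K K'P KP K'K) := trivP.
  by move/disjointFl/(_ vK) => ->.
by split=> //; apply: critical_simple => //; apply: lP.
Qed.

Definition adjacent_block a K := [exists x in K, e a x].

(** Blocks with a zero that are not adjacent to [X] stay separated when [X] is put back. So
    [m (S :\: (A :\: X))] is at least [m S + #|A|] minus the number of adjacent ones, while [m_geD]
    bounds it by [m S + #|A| - #|X|]. *)
Lemma barrier_expands S A P X : barrier S A -> blocks e P (S :\: A) -> X \subset A ->
  (forall K, K \in P -> (0 < m K)%N -> m K = 1%N) ->
  (#|X| <= #|[set K in P | (0 < m K)%N && [exists a in X, adjacent_block a K]]|)%N.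
Proof.
move=> /andP[AS /eqP mA] bP XA m1; set N := [set K in P | _].
pose C := [set K in P | (0 < m K)%N].
have [/and3P[/eqP covP trivP P0] lP cP] := bP.
have NC : N \subset C by apply/subsetP => K; rewrite !inE => /and3P[-> ->].
have CP : C \subset P by apply/subsetP => K; rewrite inE => /andP[].
have mC : m (S :\: A) = #|C|.
  rewrite (m_blocks_sum bP) (big_setID C) /= [X in (_ + X)%N]big1 ?addn0; last first.
    by move=> K; rewrite !inE negb_and => /andP[/orP[/negPf->//|]]; rewrite -leqNgt leqn0 => /eqP.
  rewrite (setIidPr CP) -sum1_card; apply: eq_bigr => K; rewrite inE => /andP[KP mK].
  exact: m1.
have bCN := blocks_cover bP (subset_trans (subsetDl C N) CP).
have mCN : m (cover (C :\: N)) = (#|C| - #|N|)%N.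
  rewrite (m_blocks_sum bCN) -(cardsDS NC) -sum1_card; apply: eq_bigr => K.
  by rewrite !inE => /andP[_ /andP[KP mK]]; apply: m1.
pose S' := S :\: (A :\: X).
have covS' : cover (C :\: N) \subset S'.
  apply/subsetP => x /bigcupP[K /setDP[/(subsetP CP) KP _] xK].
  have : x \in S :\: A by rewrite -covP; apply/bigcupP; exists K.
  by rewrite !inE => /andP[/negPf -> ->]; rewrite andbF.
have mS' : (m (cover (C :\: N)) <= m S')%N.
  rewrite -[S'](setID _ (cover (C :\: N))) (setIidPr covS') m_setU ?leq_addr //.
    by rewrite disjoint_sym disjoints_subset; apply/subsetP => z; rewrite !inE => /andP[].
  move=> u v /bigcupP[K KCN uK] /setDP[vS' vcov]; apply/negP => euv.
  have /setDP[KC KN] := KCN; have KP := subsetP CP K KC.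
  have [vX|vX] := boolP (v \in X).
    case/negP: KN; move: KC; rewrite !inE => /andP[-> ->] /=.
    apply/exists_inP; exists v => //; apply/exists_inP; exists u => //.
    by rewrite weight_sym.
  have vSA : v \in S :\: A by move: vS'; rewrite !inE (negPf vX) andTb.
  by case/negP: vcov; apply/bigcupP; exists K => //; apply: cP euv.
have := m_geD (subset_trans (subsetDl A X) AS); rewrite -/S'.
rewrite (cardsDS XA); have := subset_leq_card XA; have := subset_leq_card NC.
lia.
Qed.

(* The trees among the critical blocks must all be matched with barrier vertices,
   whence the [m S] extra left vertices, which only accept the other blocks. *)
Lemma barrier_cycles S (tree : pred {set V}) :
  (forall A P (T : {set {set V}}), A \subset S -> blocks e P (S :\: A) -> T \subset P ->
     (forall K, K \in T -> [/\ critical K, m K = 1%N & tree K]) ->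
     (#|T| <= #|[set a in A | [exists K in T, adjacent_block a K]]|)%N) ->
  exists2 U : 'I_(m S) -> {set V},
    (forall i j, i != j -> [disjoint U i & U j]) /\ (forall i, ~~ tree (U i))
  & forall C : 'I_(m S) -> {set V},
      (forall i, C i \subset U i) -> (forall i, m (U i :\: C i) = 0%N) ->
      m (S :\: \bigcup_i C i) = 0%N.
Proof.
move=> noAomoto; have [A bA npos] := maximal_barrier S.
have [P bP] := blocks_exist weight_sym weight_irr (S :\: A).
have [AS mA] : A \subset S /\ m (S :\: A) = (m S + #|A|)%N by case/andP: bA => ? /eqP.
have criticalP K : K \in P -> (0 < m K)%N -> critical K /\ m K = 1%N.
  by move=> KP mK; apply: (barrier_block_critical bA npos bP).
have m1 K : K \in P -> (0 < m K)%N -> m K = 1%N by move=> KP /(criticalP K KP)[].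
have [/and3P[/eqP covP trivP P0] lP cP] := bP.
pose C := [set K in P | (0 < m K)%N].
have CP : C \subset P by apply/subsetP => K; rewrite inE => /andP[].
have cC : #|C| = (m S + #|A|)%N.
  rewrite -mA (m_blocks_sum bP) (big_setID C) /= [X in (_ + X)%N]big1 ?addn0; last first.
    by move=> K; rewrite !inE negb_and => /andP[/orP[/negPf->//|]]; rewrite -leqNgt leqn0 => /eqP.
  rewrite (setIidPr CP) -sum1_card; apply: eq_bigr => K; rewrite inE => /andP[KP mK].
  by rewrite m1.
(* With [m S] dummy vertices added to the barrier, there are as many left vertices as critical
   blocks. *)
pose D : {set V + 'I_(m S)} := [set i | if i is inl a then a \in A else true].
pose rl (i : V + 'I_(m S)) K := (K \in C) &&
  if i is inl a then adjacent_block a K else ~~ tree K.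
have cardX (X : {set V + 'I_(m S)}) :
    #|X| = (#|[set a | inl a \in X]| + #|[set i | inr i \in X]|)%N.
  rewrite -!sum1dep_card -sum1_card.
  by rewrite big_sumType.
have cD : #|D| = (m S + #|A|)%N.
  rewrite cardX addnC; congr (_ + _)%N; last by apply: eq_card => a; rewrite !inE.
  by rewrite -[RHS]card_ord -cardsT; apply: eq_card => i; rewrite !inE.
have [|f [injf rf]] := @hall _ _ set0 rl D.
  move=> X XD; rewrite cardX; set XA := [set a | _]; set XI := [set i | _].
  have XAA : XA \subset A.
    by apply/subsetP => a; rewrite inE => /(subsetP XD); rewrite inE.
  have [XI0|/set0Pn[i0 i0X]] := eqVneq XI set0.
    rewrite XI0 cards0 addn0; apply: leq_trans (barrier_expands bA bP XAA m1) _.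
    apply: subset_leq_card; apply/subsetP => K; rewrite inE => /and3P[KP mK /exists_inP[a aX aK]].
    by apply/neighborsP; exists (inl a); [rewrite inE in aX | rewrite /rl inE KP mK].
  (* Once [X] contains a dummy vertex, it can miss only the blocks in [T]; the hypothesis bounds
     their number by that of the barrier vertices outside [XA]. *)
  pose T := [set K in C | tree K && ~~ [exists a in XA, adjacent_block a K]].
  have TC : T \subset C by apply/subsetP => K; rewrite inE => /andP[].
  have cT : (#|T| <= #|A| - #|XA|)%N.
    rewrite -(cardsDS XAA); apply: leq_trans (noAomoto A P T AS bP _ _) _.
    - exact: subset_trans CP.
    - by move=> K; rewrite !inE => /and3P[/andP[KP mK] trK _]; have [] := criticalP K KP mK.
    apply: subset_leq_card; apply/subsetP => a; rewrite inE => /andP[aA /exists_inP[K KT aK]].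
    rewrite inE aA andbT; apply/negP => aXA; move: KT; rewrite inE => /and3P[_ _ /negP[]].
    by apply/exists_inP; exists a.
  have : C :\: T \subset neighbors rl X.
    apply/subsetP => K /setDP[KC]; rewrite inE KC /= negb_and negbK.
    case/orP => [ntr|/exists_inP[a aX aK]].
      by apply/neighborsP; exists (inr i0); [rewrite inE in i0X | rewrite /rl KC].
    by apply/neighborsP; exists (inl a); [rewrite inE in aX | rewrite /rl KC].
  move/subset_leq_card; rewrite (cardsDS TC) cC; apply: leq_trans.
  have leXI : (#|XI| <= m S)%N by rewrite -[X in (_ <= X)%N]card_ord max_card.
  have leXA : (#|XA| <= #|A|)%N := subset_leq_card XAA.
  by clear -cT leXI leXA; lia.
have fC i : i \in D -> f i \in C by move=> /rf/andP[].
have fP i : i \in D -> f i \in P by move=> /fC/(subsetP CP).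
have inrD i : inr i \in D by rewrite inE.
have inlD a : a \in A -> inl a \in D by rewrite inE.
have fdisj i j : i \in D -> j \in D -> i != j -> [disjoint f i & f j].
  move=> iD jD ij; apply: (trivIsetP trivP); rewrite ?fP //.
  by apply: contra_neq ij; apply: injf.
(* Equal cardinalities make [f] onto: no critical block is left unmatched. *)
have imf : f @: D = C.
  apply/eqP; rewrite eqEcard card_in_imset // cD cC leqnn andbT.
  by apply/subsetP => _ /imsetP[i iD ->]; apply: fC.
exists (fun i => f (inr i)).
  split=> [i j ij|i]; first by apply: fdisj.
  by case/andP: (rf _ (inrD i)).
move=> Cy CyU mCy; set cyc := \bigcup_i Cy i.
have cycB : cyc \subset S :\: A.
  apply/bigcupsP => i _; apply: subset_trans (CyU i) _.
  by rewrite -covP; apply: (bigcup_max (f (inr i))); rewrite ?fP.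
pose Q := (S :\: A) :\: cyc.
pose d a := odflt a [pick x in f (inl a) | e a x].
have dP a : a \in A -> d a \in f (inl a) /\ e a (d a).
  move=> aA; have /andP[_ /exists_inP[x xf eax]] := rf _ (inlD a aA).
  by rewrite /d; case: pickP => [y /andP[]//|/(_ x)]; rewrite /= xf eax.
have fcyc a : a \in A -> [disjoint f (inl a) & cyc].
  move=> aA; rewrite /cyc; apply/bigcup_disjointP => i _.
  by apply: disjointWr (CyU i) _; apply: fdisj; rewrite ?inlD.
have dA a b : a \in A -> b \in A -> d a \in f (inl b) -> a = b.
  move=> aA bA' dab; apply/eqP; apply: contraT => ab.
  have := fdisj (inl a) (inl b) (inlD _ aA) (inlD _ bA'); rewrite (inj_eq inl_inj) => /(_ ab).
  by move/disjointFr/(_ (dP a aA).1); rewrite dab.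
pose s := [seq (a, d a) | a <- enum A].
have s1 : unzip1 s = enum A by rewrite /unzip1 -map_comp map_id.
have s2 : unzip2 s = [seq d a | a <- enum A] by rewrite /unzip2 -map_comp.
have AE : [set a in unzip1 s] = A by apply/setP => a; rewrite inE s1 mem_enum.
have SE : S :\: cyc = Q :|: A.
  apply/setP => z; rewrite !inE; have [zA|] := boolP (z \in A); last by rewrite orbF.
  rewrite (subsetP AS z zA) orbT andbT; apply/negP => /(subsetP cycB).
  by rewrite inE zA.
have mQ_ge : (#|A| <= m Q)%N.
  rewrite /Q setDE (m_blocks _ bP).
  have sub : [set f (inl a) | a in A] \subset P.
    by apply/subsetP => _ /imsetP[a aA ->]; apply: fP; apply: inlD.
  rewrite (big_setID [set f (inl a) | a in A]) /= (setIidPr sub).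
  apply: leq_trans (leq_addr _ _).
  rewrite big_imset /=; last by move=> a b aA bA' /injf; rewrite !inlD // => /(_ isT isT) [].
  rewrite -sum1_card; apply: leq_sum => a aA.
  rewrite (setIidPl _) -?disjoints_subset ?fcyc //.
  by have := fC _ (inlD a aA); rewrite inE => /andP[].
pose DD := [set x in unzip2 s].
have DDQ : {subset unzip2 s <= Q}.
  move=> x; rewrite s2 => /mapP[a]; rewrite mem_enum => aA ->.
  have [daf _] := dP a aA; rewrite inE (disjointFr (fcyc a aA) daf) /=.
  by rewrite -covP; apply/bigcupP; exists (f (inl a)) => //; rewrite fP ?inlD.
(* Blocks without a zero are untouched; a block matched with [a] loses [d a], which is enough by
   criticality; the others lose their set [Cy i]. *)
have mQD : m (Q :\: DD) = 0%N.
  rewrite /Q setDDl setDE (m_blocks _ bP) big1 // => K KP; rewrite -setDE -setDDl.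
  have [mK0|mK] := posnP (m K).
    have KE : K :\: cyc :\: DD = K.
      rewrite setDDl; apply/setDidPl; rewrite disjoint_sym -setI_eq0; apply/eqP/setP => z.
      rewrite !inE; apply/negP => /andP[/orP[/bigcupP[i _ zi]|]] => [zK|].
        have /trivIsetP/(_ (f (inr i)) K (fP _ (inrD i)) KP) := trivP.
        have -> : f (inr i) != K.
          by apply: contraTneq (fC _ (inrD i)) => ->; rewrite inE mK0 andbF.
        by move/(_ isT)/disjointFr/(_ (subsetP (CyU i) z zi)); rewrite zK.
      rewrite s2 => /mapP[a]; rewrite mem_enum => aA -> zK.
      have /trivIsetP/(_ (f (inl a)) K (fP _ (inlD a aA)) KP) := trivP.
      have -> : f (inl a) != K.
        by apply: contraTneq (fC _ (inlD a aA)) => ->; rewrite inE mK0 andbF.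
      by move/(_ isT)/disjointFr/(_ (dP a aA).1); rewrite zK.
    by rewrite KE.
  have : K \in f @: D by rewrite imf inE KP.
  case/imsetP => -[a|i] iD KE; rewrite KE.
    have aA : a \in A by move: iD; rewrite inE.
    rewrite (setDidPl (fcyc a aA)).
    have -> : f (inl a) :\: DD = f (inl a) :\ d a.
      apply/setP => z; rewrite !inE; have [zf|] := boolP (z \in f (inl a)); last by rewrite !andbF.
      rewrite !andbT s2; congr negb; apply/mapP/eqP => [[b]|->].
        by rewrite mem_enum => bA' zE; rewrite zE (dA b a) // -zE.
      by exists a; rewrite ?mem_enum.
    have [cK mK1] := criticalP K KP mK; rewrite KE in cK mK1.
    by have := cK.2 (d a) (dP a aA).1; rewrite mK1 => -[].
  have -> : f (inr i) :\: cyc :\: DD = f (inr i) :\: Cy i.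
    rewrite setDDl; apply/setP => z; rewrite !inE.
    have [zf|] := boolP (z \in f (inr i)); last by rewrite !andbF.
    rewrite !andbT; congr negb; apply/orP/idP => [[/bigcupP[j _ zj]|]|zi].
    - have [<-//|ji] := eqVneq j i.
      have := fdisj (inr j) (inr i) (inrD _) (inrD _); rewrite (inj_eq inr_inj) => /(_ ji).
      by move/disjointFr/(_ (subsetP (CyU j) z zj)); rewrite zf.
    - rewrite s2 => /mapP[a]; rewrite mem_enum => aA zE.
      have := fdisj (inl a) (inr i) (inlD _ aA) (inrD _) isT.
      by move/disjointFr/(_ (dP a aA).1); rewrite -zE zf.
    by left; apply/bigcupP; exists i.
  exact: mCy.
have usz : uniq (unzip2 s).
  rewrite s2 map_inj_in_uniq ?enum_uniq // => a b; rewrite !mem_enum => aA bA' dE.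
  by apply: dA => //; rewrite dE; case: (dP b bA').
have mQ : m Q = size s.
  rewrite size_map -cardE; apply/eqP; rewrite eqn_leq mQ_ge andbT.
  have := @m_leD Q DD; rewrite mQD cardsE (card_uniqP usz) s2 !size_map -cardE; apply.
  by apply/subsetP => z; rewrite inE; apply: DDQ.
apply/eqP; rewrite -leqn0 leqNgt -mu_theta_eq0 SE -AE.
apply: augment_neq0 => //.
- by rewrite s1 enum_uniq.
- rewrite AE -setI_eq0; apply/eqP/setP => z; rewrite !inE; case: (z \in A); rewrite ?andbF //.
- by move=> p /mapP[a]; rewrite mem_enum => aA ->; case: (dP a aA).
by rewrite mu_theta_eq0 -/DD mQD.
Qed.

End Mu.

(** * Matchings of a weighted multi-graph *)

Section Matchings.
Variables (R : realType) (V A : finType) (G : wmgraph R V A).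
Implicit Types (a b : A) (c : seq A) (u v x y : V) (S K : {set V}) (M : {set {set A}}).

Definition edge_of a : {set A} := [set a; ainv G a].

Lemma ter_ainv a : a \in aset G -> ter G (ainv G a) = org G a.
Proof. by move=> aG; rewrite /ter ainvK. Qed.

Lemma edgesP (f : {set A}) a : f \in edges G -> a \in f -> a \in aset G /\ f = edge_of a.
Proof.
case/imsetP => b bG -> /set2P[] -> //; split; first exact: ainv_aset.
by rewrite /edge_of ainvK // setUC.
Qed.

Lemma cover_edges M a : M \subset edges G -> a \in cover M -> a \in aset G /\ edge_of a \in M.
Proof.
move=> ME /bigcupP[f fM af]; have [aG <-] := edgesP (subsetP ME f fM) af.
by split.
Qed.

(** Injectivity of the origin on the covered arcs says both that the edges are disjoint and that
    none is a loop, whose two arcs share their origin. *)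
Lemma matchingP M :
  reflect (M \subset edges G /\ {in cover M &, injective (org G)}) (is_matching G M).
Proof.
apply: (iffP andP) => -[ME H]; split=> //.
  move=> a b aM bM ab.
  have /cards1P[c cE] := forall_inP H _ (imset_f (org G) aM).
  have : a \in [set c] by rewrite -cE inE aM eqxx.
  have : b \in [set c] by rewrite -cE inE bM ab eqxx.
  by move=> /set1P-> /set1P->.
apply/forall_inP => v /imsetP[a aM ->]; apply/cards1P; exists a.
apply/setP => b; rewrite !inE; apply/andP/eqP => [[bM /eqP]|->]; first exact: H.
by rewrite aM eqxx.
Qed.

Lemma saturated_set0 : saturated G set0 = set0.
Proof. by rewrite /saturated /cover big_set0 imset0. Qed.

Lemma cover_setU1 (f : {set A}) M : cover (f |: M) = f :|: cover M.
Proof. by rewrite /cover bigcup_setU big_set1. Qed.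

Lemma saturated_setU1 a M :
  saturated G (edge_of a |: M) = [set org G a; ter G a] :|: saturated G M.
Proof. by rewrite /saturated cover_setU1 imsetU imsetU1 imset_set1. Qed.

Lemma matching_org_neq_ter M a : is_matching G M -> a \in cover M -> org G a != ter G a.
Proof.
case/matchingP => ME inj aM; have [aG eM] := cover_edges ME aM.
rewrite /ter; apply: contraTneq (ainv_neq aG) => E; rewrite negbK.
apply/eqP; apply: inj => //.
by apply/bigcupP; exists (edge_of a); rewrite // set22.
Qed.

Lemma matching_setU1 M a : a \in aset G -> is_matching G M -> org G a != ter G a ->
  org G a \notin saturated G M -> ter G a \notin saturated G M ->
  is_matching G (edge_of a |: M) /\ edge_of a \notin M.
Proof.
move=> aG /matchingP[ME inj] ot oM tM.
have notin b : b \in edge_of a -> b \notin cover M.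
  by case/set2P => ->; [apply: contra oM | apply: contra tM] => ?; apply: imset_f.
split; last first.
  apply: contra (notin a (set21 _ _)) => eM; apply/bigcupP.
  by exists (edge_of a); rewrite // set21.
apply/matchingP; split.
  by rewrite subUset ME sub1set andbT; apply/imsetP; exists a.
have orgin b d : b \in edge_of a -> d \in cover M -> org G b != org G d.
  move=> be dM; have : org G d \in saturated G M by apply: imset_f.
  by case/set2P: be => ->; apply: contraTneq => <-.
rewrite cover_setU1 => b c /setUP[be|bM] /setUP[ce|cM] E.
- case/set2P: be E => ->; case/set2P: ce => -> // E.
    by rewrite /ter E eqxx in ot.
  by rewrite /ter E eqxx in ot.
- by have := orgin _ _ be cM; rewrite E eqxx.
- by have := orgin _ _ ce bM; rewrite E eqxx.
exact: inj.
Qed.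

Lemma matching_setD1 M a : is_matching G M -> a \in cover M ->
  is_matching G (M :\ edge_of a) /\
  [disjoint [set org G a; ter G a] & saturated G (M :\ edge_of a)].
Proof.
move=> mM aM; have /matchingP[ME inj] := mM; have [aG eM] := cover_edges ME aM.
have cD b : b \in cover (M :\ edge_of a) -> b \in cover M.
  by case/bigcupP => f /setD1P[_ fM] bf; apply/bigcupP; exists f.
have M'E : M :\ edge_of a \subset edges G by apply: subset_trans ME; apply: subsetDl.
split; first by apply/matchingP; split=> // b c /cD bM /cD cM; apply: inj.
have aD b : b \in edge_of a -> b \notin cover (M :\ edge_of a).
  move=> be; apply/negP => bc; have [_] := cover_edges M'E bc.
  have aeE : edge_of a \in edges G by apply: (subsetP ME).
  by have [_ <-] := edgesP aeE be; rewrite !inE eqxx.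
have ecov b : b \in edge_of a -> b \in cover M by move=> be; apply/bigcupP; exists (edge_of a).
rewrite -setI_eq0; apply/eqP/setP => v; rewrite in_setI [RHS]inE.
apply/negP => /andP[vo /imsetP[b bc vE]].
have [d de vd] : exists2 d, d \in edge_of a & v = org G d.
  by case/set2P: vo => ->; [exists a | exists (ainv G a)]; rewrite ?set21 ?set22.
have db : d = b by apply: inj; [exact: ecov | exact: cD | rewrite -vd].
by have := aD d de; rewrite db bc.
Qed.

Definition arc_wt a : R := ComplexField.Normc.normc (awt G a) ^+ 2.

Lemma arc_wt_ge0 a : 0 <= arc_wt a.
Proof. exact: sqr_ge0. Qed.

Lemma arc_wtE a : ((arc_wt a)%:C = awt G a * (awt G a)^*)%C.
Proof. by rewrite -sqr_normc rmorphXn. Qed.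

Lemma arc_wt_ainv a : a \in aset G -> arc_wt (ainv G a) = arc_wt a.
Proof.
by move=> aG; rewrite /arc_wt awt_ainv //; case: (awt G a) => x y /=; rewrite sqrrN.
Qed.

Lemma arc_wt_gt0 a : a \in aset G -> 0 < arc_wt a.
Proof.
move=> aG; rewrite lt0r arc_wt_ge0 andbT sqrf_eq0.
by apply: contra (awt_neq0 aG) => /eqP/ComplexField.Normc.eq0_normc ->.
Qed.

Lemma edge_wtE a : a \in aset G -> edge_wt G (edge_of a) = - arc_wt a.
Proof.
move=> aG; rewrite /edge_wt; case: pickP => [b|/(_ a)]; last by rewrite set21.
by rewrite -!/(arc_wt _) => /set2P[] ->; rewrite -/(arc_wt _) ?arc_wt_ainv.
Qed.

(* The matching polynomial depends on the arcs only through these sums. *)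
Definition nbr_wt u v : R :=
  if u == v then 0 else \sum_(a in aset G | (org G a == u) && (ter G a == v)) arc_wt a.

Lemma nbr_wtE u v : u != v ->
  nbr_wt u v = \sum_(a in aset G | (org G a == u) && (ter G a == v)) arc_wt a.
Proof. by rewrite /nbr_wt => /negPf ->. Qed.

Lemma nbr_wt_ge0 u v : 0 <= nbr_wt u v.
Proof. by rewrite /nbr_wt; case: eqP => // _; apply: sumr_ge0 => a _; apply: arc_wt_ge0. Qed.

Lemma nbr_wt_diag v : nbr_wt v v = 0.
Proof. by rewrite /nbr_wt eqxx. Qed.

Lemma nbr_wt_sym u v : nbr_wt u v = nbr_wt v u.
Proof.
rewrite /nbr_wt eq_sym; case: eqP => // _.
rewrite (reindex_onto (ainv G) (ainv G)) /=; last by move=> a /andP[aG _]; rewrite ainvK.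
apply: eq_big => a.
  apply/andP/and3P => [[/and3P[iG /eqP ou /eqP tv] /eqP aK]|[aG /eqP oa /eqP ta]].
    have aG : a \in aset G by rewrite -aK ainv_aset.
    by split; rewrite // -?tv -?ou ?ter_ainv.
  by rewrite ainvK // eqxx ainv_aset // ter_ainv // oa -ta /ter !eqxx.
by move=> /andP[/and3P[iG _ _] /eqP aK]; rewrite arc_wt_ainv // -aK ainv_aset.
Qed.

Lemma nbr_wt_gt0P u v : reflect (u != v /\ adjacent G u v) (0 < nbr_wt u v).
Proof.
rewrite /nbr_wt; case: eqP => [_|_] /=; first by rewrite ltxx; constructor => -[].
rewrite lt0r sumr_ge0 ?andbT => [|a _]; last exact: arc_wt_ge0.
rewrite psumr_neq0 => [|a _]; last exact: arc_wt_ge0.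
apply: (iffP hasP) => [[a _ /andP[/and3P[aG oa ta] _]]|[_ /exists_inP[a aG oat]]].
  by split=> //; apply/exists_inP; exists a; rewrite ?oa.
by exists a; rewrite ?mem_index_enum // aG oat arc_wt_gt0.
Qed.

(** Written with matchings of the fixed graph [G], so that the recursion never changes the graph;
    [matching_poly_induced] gives the link to induced subgraphs. *)
Definition mu S : {poly R} :=
  \sum_(M : {set {set A}} | is_matching G M && (saturated G M \subset S))
    (\prod_(v in S :\: saturated G M) ('X - (vwt G v)%:P)
     * \prod_(f in M) (edge_wt G f)%:P).

Lemma mu_set0 : mu set0 = 1.
Proof.
have m0 : is_matching G set0.
  apply/matchingP; rewrite sub0set; split=> // a b.
  by rewrite /cover big_set0 inE.
rewrite /mu (bigD1 set0) /= ?m0 ?saturated_set0 ?sub0set //.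
rewrite big_set0 mulr1 setD0 big_set0 big1 ?addr0 // => M /andP[/andP[/matchingP[ME _]]].
rewrite subset0 => /eqP sM0 /negP[]; apply/set0Pn => -[f fM].
have /imsetP[a aG fE] := subsetP ME f fM.
have : org G a \in saturated G M.
  by apply: imset_f; apply/bigcupP; exists f => //; rewrite fE set21.
by rewrite sM0 inE.
Qed.

Lemma muD1 S v : v \in S ->
  mu S = ('X - (vwt G v)%:P) * mu (S :\ v)
         - \sum_(y in S :\ v) nbr_wt v y *: mu (S :\ v :\ y).
Proof.
move=> vS; pose F S' M := \prod_(v in S' :\: saturated G M) ('X - (vwt G v)%:P)
     * \prod_(f in M) (edge_wt G f)%:P.
rewrite {1}/mu (bigID (fun M => v \in saturated G M)) /= addrC; congr (_ + _).
  rewrite /mu mulr_sumr; apply: eq_big => [M|M /andP[/andP[mM MS] vM]].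
    rewrite -andbA; congr (_ && _); rewrite subsetD1 andbC; by rewrite andbC.
  rewrite mulrA; congr (_ * _); rewrite (big_setD1 v) /=; last by rewrite inE vM.
  by congr (_ * _); apply: eq_bigl => x; rewrite !inE andbCA.
pose At := [set a in aset G | (org G a == v) && (ter G a \in S :\ v)].
(* A matching that saturates [v] covers exactly one arc of [At], so the inner sum has one term.
   Exchanging the sums sorts the matchings by this arc, and grouping arcs by terminus then adds up
   parallel edges. *)
transitivity (\sum_(M | is_matching G M && (saturated G M \subset S) && (v \in saturated G M))
    \sum_(a in At | a \in cover M) F S M).
  apply: eq_bigr => M /andP[/andP[mM MS] /imsetP[a aM va]].
  have /matchingP[ME inj] := mM; have [aG eM] := cover_edges ME aM.
  rewrite (big_pred1 a) // => b; rewrite !inE; apply/idP/eqP => [|->].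
    by move=> /andP[/and3P[_ /eqP bv _] bM]; apply: inj; rewrite // bv.
  rewrite aG aM va eqxx /= andbT eq_sym (matching_org_neq_ter mM aM) /=.
  apply: (subsetP MS); apply: imset_f; apply/bigcupP.
  by exists (edge_of a); rewrite // set22.
rewrite (exchange_big_dep (mem At)) /=; last by move=> M a _ /andP[].
have step a : a \in At ->
  \sum_(M | is_matching G M && (saturated G M \subset S) && (v \in saturated G M)
       && ((a \in At) && (a \in cover M))) F S M = - (arc_wt a *: mu (S :\ v :\ ter G a)).
  move=> aAt; have /and4P[aG /eqP ov tv tS] :
      [&& a \in aset G, org G a == v, ter G a != v & ter G a \in S].
    by move: aAt; rewrite !inE.
  rewrite (reindex_onto (fun M => edge_of a |: M) (fun M => M :\ edge_of a)) /=; last first.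
    move=> M /andP[/andP[/andP[/matchingP[ME _] _] _] /andP[_ aM]].
    by rewrite setD1K // (cover_edges ME aM).2.
  have ot : org G a != ter G a by rewrite ov eq_sym.
  have acov M : a \in cover (edge_of a |: M) by rewrite cover_setU1 !inE eqxx.
  rewrite /mu scaler_sumr -sumrN; apply: eq_big => [M|M].
    rewrite aAt acov !andbT; apply/idP/idP.
      move=> /andP[/andP[/andP[mM MS] _] /eqP ME].
      have [] := matching_setD1 mM (acov M); rewrite ME => -> dM /=.
      apply/subsetP => x xM; rewrite !inE (subsetP MS) ?saturated_setU1 ?inE ?xM ?orbT //.
      by have := disjointFl dM xM; rewrite !inE ov => /norP[-> ->].
    move=> /andP[mM MS].
    have nin x : x \in [set v; ter G a] -> x \notin saturated G M.
      move=> xva; apply: contraTN xva => /(subsetP MS).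
      by rewrite !inE => /and3P[/negPf-> /negPf->].
    have oM : org G a \notin saturated G M by apply: nin; rewrite ov set21.
    have tM : ter G a \notin saturated G M by apply: nin; rewrite set22.
    have [mU nM] := matching_setU1 aG mM ot oM tM.
    rewrite mU setU1K // eqxx andbT /=.
    rewrite saturated_setU1 !inE ov eqxx andbT !subUset !sub1set vS tS /=.
    by apply: subset_trans MS _; rewrite setDDl subsetDl.
  move=> /andP[/andP[/andP[/andP[mM MS] _] _] /eqP ME].
  have [_] := matching_setD1 mM (acov M); rewrite ME => dM.
  have eM : edge_of a \notin M by rewrite -ME !inE eqxx.
  rewrite /F big_setU1 //= edge_wtE // polyCN mulNr mulrN -mul_polyC; congr (- _).
  rewrite [RHS]mulrA mulrCA mulrA; congr (_ * _ * _); apply: eq_bigl => x.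
  rewrite saturated_setU1 !inE ov negb_or.
  have [xM|_] := boolP (x \in saturated G M); first by rewrite !andbF.
  by rewrite negb_or andbT -!andbA; case: (x == v); case: (x == ter G a).
rewrite (eq_bigr _ step) sumrN; congr (- _).
rewrite (partition_big (ter G) (mem (S :\ v))) /=; last by move=> a; rewrite inE => /and3P[].
apply: eq_bigr => y yS; rewrite /nbr_wt ifN; last by rewrite eq_sym; case/setD1P: yS.
rewrite scaler_suml; apply: eq_big => [a|a /andP[_ /eqP ->] //].
rewrite !inE -!andbA; congr (_ && (_ && _)).
case: (ter G a =P y) => [->|_]; rewrite ?andbF ?andbT //.
by move: yS; rewrite !inE.
Qed.


End Matchings.

(** * Critical components without good cycle are trees *)

Section Blocks.
Variables (R : realType) (V A : finType) (G : wmgraph R V A).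
Implicit Types (a b : A) (c : seq A) (u v x y : V) (S K : {set V}) (M : {set {set A}}).
Local Notation edge_of := (edge_of G).
Local Notation mu := (mu G).
Local Notation nbr_wt := (nbr_wt G).

Lemma matching_poly_induced S : matching_poly (induced G S) = mu (vset G :&: S).
Proof.
have satE M : saturated (induced G S) M = saturated G M by [].
apply: eq_big => [M|M _] //.
apply/matchingP/andP => [[ME inj]|[/matchingP[ME inj] MS]].
  have sub a : a \in cover M -> a \in induced_aset G S by move=> /(cover_edges ME)[].
  have MG : M \subset edges G.
    apply: subset_trans ME _; apply/subsetP => _ /imsetP[a aS ->].
    by apply/imsetP; exists a => //; apply: induced_sub aS.
  split; first by apply/matchingP.
  apply/subsetP => _ /imsetP[a /sub aS ->].
  by have := induced_org aS.
have sub a : a \in cover M -> org G a \in vset G :&: S.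
  by move=> aM; apply: (subsetP MS); apply: imset_f.
split=> //; apply/subsetP => f fM; have /imsetP[a aG fE] := subsetP ME f fM.
have cf b : b \in f -> b \in cover M by move=> bf; apply/bigcupP; exists f.
have := sub a (cf a _); have := sub (ainv G a) (cf _ _).
rewrite fE set21 set22 => /(_ isT) /setIP[_ tS] /(_ isT) /setIP[_ oS].
by apply/imsetP; exists a; rewrite // inE aG oS.
Qed.

Lemma matching_poly_mu : matching_poly G = mu (vset G).
Proof.
apply: eq_bigl => M; case: (boolP (is_matching G M)) => //= /matchingP[ME _].
apply/esym/subsetP => _ /imsetP[a aM ->]; apply: org_vset.
by have [] := cover_edges ME aM.
Qed.

Variable theta : R.
Let m S := mup theta (mu S).
Let e : rel V := fun x y => 0 < nbr_wt x y.

Let e_sym : symmetric e 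
  := weight_sym (@nbr_wt_sym _ _ _ G).
Let e_irr : irreflexive e 
  := weight_irr (@nbr_wt_diag _ _ _ G).

Lemma adjacentE x y : x != y -> adjacent G x y = e x y.
Proof. by move=> xy; apply/idP/nbr_wt_gt0P => [|[]]. Qed.

Lemma adjacent_sym : symmetric (adjacent G).
Proof.
have H x y : adjacent G x y -> adjacent G y x.
  case/exists_inP => a aG /andP[/eqP <- /eqP <-]; apply/exists_inP.
  by exists (ainv G a); rewrite ?ainv_aset // ter_ainv // /ter !eqxx.
by move=> x y; apply/idP/idP; apply: H.
Qed.

Lemma edge_arc x y : e x y -> exists2 a, a \in aset G & org G a = x /\ ter G a = y.
Proof.
by case/nbr_wt_gt0P => _ /exists_inP[a aG /andP[/eqP oa /eqP ta]]; exists a.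
Qed.

Lemma arc_edge a : a \in aset G -> org G a != ter G a -> e (org G a) (ter G a).
Proof.
move=> aG ot; apply/nbr_wt_gt0P; split=> //; apply/exists_inP; exists a => //.
by rewrite !eqxx.
Qed.

Definition good_cycle K (c : seq A) :=
  [/\ is_cycle G c, cycle_vset G c \subset K & m (K :\: cycle_vset G c) = 0%N].

(** Any arcs between consecutive vertices will do: two mutually inverse ones would force
    [next c (next c x) = x], impossible for length at least 3. *)
Lemma vertex_cycle (c : seq V) : (2 < size c)%N -> uniq c -> path.cycle e c ->
  exists2 d, is_cycle G d & cycle_vset G d = [set x in c].
Proof.
move=> c2 uc cyc; have c0 : c != [::] by case: (c) c2.
have [x0 _] : exists x, x \in c by case: (c) c2 => // x c' _; exists x; rewrite mem_head.
have [arc arcP] : exists arc, forall x, x \in c ->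
    [/\ arc x \in aset G, org G (arc x) = x & ter G (arc x) = next c x].
  have /fin_all_exists : forall x, exists a : option A, x \in c ->
      if a is Some a' then [/\ a' \in aset G, org G a' = x & ter G a' = next c x] else False.
    move=> x; have [xc|] := boolP (x \in c); last by exists None.
    have /edge_arc[a aG [oa ta]] := next_cycle cyc xc.
    by exists (Some a).
  case=> f fP; have [a0 _] : exists a : A, true.
    case: (c) c0 fP => // x c' _ /(_ x (mem_head _ _)); case: (f x) => // a _; by exists a.
  by exists (fun x => odflt a0 (f x)) => x /fP; case: (f x).
have orgc : map (org G) (map arc c) = c.
  by rewrite -map_comp -[RHS]map_id; apply/eq_in_map => x /arcP[].
exists (map arc c); last by rewrite /cycle_vset orgc.
apply/and5P; split.
- by case: (c) c0.
- by apply/allP => _ /mapP[x /arcP[? _ _] ->].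
- rewrite cycle_map; apply: (sub_in_cycle (P := mem c) _ _ (cycle_next uc)); last exact/allP.
  move=> x y xc yc /= /eqP nxt; have [_ _ ->] := arcP x xc; have [_ -> _] := arcP y yc.
  exact/eqP.
- by rewrite orgc.
apply/allP => _ /mapP[x xc ->]; apply/mapP => -[y yc E].
have [aG ox tx] := arcP x xc; have [_ oy ty] := arcP y yc.
have yE : y = next c x by rewrite -oy -E -tx.
have xE : x = next c y by rewrite -ty -E ter_ainv.
have [i [|x' [|y' s]] rE] := rot_to xc; have := congr1 size rE; rewrite size_rot /=; try lia.
have urot : uniq (rot i c) by rewrite rot_uniq.
move=> _; have := xE; rewrite yE -!(next_rot i uc) rE /=.
move: urot; rewrite rE /= eqxx !inE !negb_or => /andP[/and3P[xx' xy' _] _].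
by rewrite [x' == x]eq_sym (negPf xx') eqxx => /eqP; rewrite (negPf xy').
Qed.

Section TreeBlock.
Variable K : {set V}.
Hypotheses (K_sub : K \subset vset G) (K_linked : linked e K).
Hypotheses (K_crit : critical mu theta K) (K_simple : m K = 1%N).
Hypothesis K_tree : forall c, ~ good_cycle K c.

Lemma tree_no_good_cycle : no_good_cycle nbr_wt mu theta K.
Proof.
move=> c c2 uc cK cyc; rewrite lt0n; apply/eqP => mKc.
have [d cd dE] := vertex_cycle c2 uc cyc; apply: (K_tree (c := d)); split=> //.
  by rewrite dE; apply/subsetP => x; rewrite inE => /cK.
by rewrite dE.
Qed.

Lemma tree_edge u v : u \in K -> v \in K -> e u v ->
  (mu (K :\ u)).[theta] * (mu (K :\ v)).[theta]
    = nbr_wt u v * (mu (K :\ u :\ v)).[theta] ^+ 2.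
Proof.
exact: (no_good_cycle_edge (@nbr_wt_ge0 _ _ _ G) (@nbr_wt_sym _ _ _ G)
  (mu_set0 G) (@muD1 _ _ _ G) (@nbr_wt_diag _ _ _ G) tree_no_good_cycle K_simple K_crit).
Qed.

Let mu_eq0 := mu_theta_eq0 (mu_set0 G) (@muD1 _ _ _ G) theta.

Lemma crit_neq0 v : v \in K -> (mu (K :\ v)).[theta] != 0.
Proof.
move=> vK; rewrite mu_eq0 -leqNgt -ltnS; have := K_crit.2 v vK.
by rewrite -/(m _) -/(m K) K_simple => <-.
Qed.

Lemma edge_neq0 u v : u \in K -> v \in K -> e u v -> (mu (K :\ u :\ v)).[theta] != 0.
Proof.
move=> uK vK euv; have := tree_edge uK vK euv; apply: contra_eq_neq => ->.
by rewrite expr0n mulr0 mulf_neq0 ?crit_neq0.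
Qed.

(** Criticality makes a loop a good cycle: deleting its vertex removes the zero. *)
Lemma tree_loopless a : a \in aset G -> org G a \in K -> org G a != ter G a.
Proof.
move=> aG oK; apply/eqP => ot; apply: (K_tree (c := [:: a])); split.
- rewrite /is_cycle /= aG -ot eqxx /= inE andbT.
  exact: ainv_neq.
- by apply/subsetP => x; rewrite !inE => /eqP->.
have -> : cycle_vset G [:: a] = [set org G a] by apply/setP => x; rewrite !inE.
by apply/eqP; rewrite -leqn0 leqNgt -mu_eq0 crit_neq0.
Qed.

(** Two parallel edges form a cycle of length 2, which is good by [edge_neq0]. *)
Lemma tree_arc_uniq a b : a \in aset G -> b \in aset G -> org G a \in K -> ter G a \in K ->
  org G a = org G b -> ter G a = ter G b -> a = b.
Proof.
move=> aG bG oK tK oab tab; apply/eqP; apply: contraT => ab.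
have ot := tree_loopless aG oK.
case: (K_tree (c := [:: a; ainv G b])).
have vE : cycle_vset G [:: a; ainv G b] = [set org G a; ter G a].
  by apply/setP => x; rewrite !inE -/(ter G b) tab.
split.
- have ba : ainv G a != ainv G b.
    by apply: contra ab => /eqP/(congr1 (ainv G)); rewrite !ainvK // => ->.
  have ab' : b != a by rewrite eq_sym.
  apply/and5P; split=> //=.
  + by rewrite aG ainv_aset.
  + by rewrite ter_ainv // oab tab /ter !eqxx.
  + by rewrite inE -/(ter G b) -tab ot.
  by rewrite !inE ainvK // !negb_or ainv_neq // ba ab' [b == _]eq_sym ainv_neq.
- by rewrite vE; apply/subsetP => x /set2P[] ->.
rewrite vE; apply/eqP; rewrite -leqn0 leqNgt -mu_eq0 -setDDl.
by apply: edge_neq0 => //; apply: arc_edge.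
Qed.

(** The field is left open: rationals serve to exclude cycles, complex numbers to build the
    eigenvector. *)
Lemma tree_potential (F : fieldType) (g : V -> V -> F) :
  (forall u v, u \in K -> v \in K -> e u v -> g u v * g v u = 1) ->
  exists x : V -> F, (forall v, v \in K -> x v != 0) /\
    forall u v, u \in K -> v \in K -> e u v -> x v = x u * g u v.
Proof.
apply: (linked_potential e_sym e_irr K_linked).
exact: (no_good_cycle_count (@nbr_wt_ge0 _ _ _ G) (@nbr_wt_sym _ _ _ G)
  (mu_set0 G) (@muD1 _ _ _ G) (@nbr_wt_diag _ _ _ G) tree_no_good_cycle K_simple K_crit).
Qed.

(* On a cycle of length at least 3, a potential that doubles along one edge and is
   constant along the others cannot close up. *)
Lemma tree_acyclic c : is_cycle G c -> cycle_vset G c \subset K -> False.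
Proof.
case/and5P => c0 /allP cG cyc uc /allP ainvc cK.
have oK a : a \in c -> org G a \in K.
  by move=> ac; apply: (subsetP cK); rewrite inE map_f.
have tK a : a \in c -> ter G a \in K.
  by move=> ac; rewrite (eqP (next_cycle cyc ac)) oK // mem_next.
case: c c0 cG cyc uc ainvc oK tK {cK} => [|a [|b [|d c]]] // _ cG cyc uc ainvc oK tK.
- have := tree_loopless (cG a (mem_head _ _)) (oK a (mem_head _ _)).
  by move: cyc; rewrite /= andbT eq_sym => ->.
- have aG : a \in aset G by apply: cG; rewrite mem_head.
  have bG : b \in aset G by apply: cG; rewrite !inE eqxx orbT.
  move: cyc; rewrite /= andbT => /andP[/eqP tab /eqP tba].
  have := ainvc b; rewrite !inE eqxx orbT => /(_ isT) /norP[/eqP[]].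
  apply: tree_arc_uniq; rewrite ?ainv_aset // ?ter_ainv ?tab //.
  + by rewrite -/(ter G b) tba oK ?mem_head.
  by rewrite oK // !inE eqxx orbT.
pose u0 := org G a; pose u1 := org G b.
have u01 : u0 != u1 by move: uc; rewrite /= !inE !negb_or -!andbA => /and5P[].
pose g u v : rat := if (u == u0) && (v == u1) then 2%:R
  else if (u == u1) && (v == u0) then 2%:R^-1 else 1.
have [|x [x_neq0 xg]] := @tree_potential _ g.
  move=> u v _ _ _; rewrite /g; have [->|uu0] := eqVneq u u0; have [->|vu0] := eqVneq v u0;
  rewrite ?(negPf u01) ?andbF ?mulr1 //= ?andbT.
  - by case: eqP => // _; rewrite eq_sym (negPf u01) /= ?mulfV ?mulr1.
  by case: eqP => // _; rewrite ?mulVf ?mulr1.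
have step f : f \in [:: a, b, d & c] -> x (ter G f) = x (org G f) * g (org G f) (ter G f).
  move=> fc; apply: (xg _ _ (oK f fc) (tK f fc)).
  exact: (arc_edge (cG f fc) (tree_loopless (cG f fc) (oK f fc))).
have x1 : x u1 = x u0 * 2%:R.
  have := step a (mem_head _ _); move: (cyc) => /= /andP[/eqP -> _].
  by rewrite /g !eqxx.
have flat f : f \in [:: b, d & c] -> x (ter G f) = x (org G f).
  move=> fc; have fabc : f \in [:: a, b, d & c] by rewrite in_cons fc orbT.
  rewrite step //.
  have fu0 : org G f != u0.
    by apply: contraTneq uc => E; rewrite /= -/u0 -E (map_f (org G) fc).
  (* The factor 1/2 would need an arc of the cycle from [u1] to [u0]. The only arc at [u1] is [b],
     and it ends at the origin of [d], which differs from [u0]. *)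
  rewrite /g (negPf fu0) /=; have [fu1|_] /= := eqVneq (org G f) u1; last by rewrite mulr1.
  rewrite ifN ?mulr1 //.
  have fb : f = b.
    move: fc; rewrite inE => /predU1P[//|fdc].
    move: uc; rewrite /= -/u1 -fu1 => /and3P[_ /negP[]].
    exact: (map_f (org G) fdc).
  move: cyc; rewrite fb /= => /and3P[_ /eqP -> _].
  by rewrite eq_sym; move: uc; rewrite /= !inE !negb_or -!andbA => /and3P[].
have close l f : {subset f :: l <= [:: b, d & c]} ->
    path (fun p q => ter G p == org G q) f (rcons l a) -> x u0 = x (org G f).
  elim: l f => [|f' l IHl] f sub /=.
    by rewrite andbT => /eqP E; rewrite -flat ?E // sub ?mem_head.
  move=> /andP[/eqP E pth]; rewrite (IHl f') //; last by move=> z zl; rewrite sub // inE zl orbT.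
  by rewrite -E flat // sub ?mem_head.
have := close (d :: c) b (fun z h => h); move: cyc; rewrite /= => /andP[_ ->] /(_ isT).
rewrite -/u1 x1 => /eqP; rewrite -subr_eq0 -{1}[x u0]mulr1 -mulrBr mulf_eq0.
by rewrite (negPf (x_neq0 _ _)) // oK // mem_head.
Qed.

Lemma tree_vertex v : v \in K ->
  (theta - vwt G v) * (mu (K :\ v)).[theta]
    = \sum_(u in K :\ v) nbr_wt v u * (mu (K :\ v :\ u)).[theta].
Proof.
move=> vK; apply/eqP; rewrite -subr_eq0.
have : (mu K).[theta] == 0 by rewrite mu_eq0 -/(m K) K_simple.
rewrite (muD1 G vK) !hornerE [X in _ - X == _]horner_sum.
by under eq_bigr do rewrite hornerZ.
Qed.

Definition arc_sum u v : R[i] :=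
  \sum_(a in aset G | (org G a == u) && (ter G a == v)) awt G a.

Lemma arc_sum_unique a : a \in aset G -> org G a \in K -> ter G a \in K ->
  arc_sum (org G a) (ter G a) = awt G a.
Proof.
move=> aG oK tK; rewrite /arc_sum (big_pred1 a) // => b.
apply/idP/eqP => [|->]; last by rewrite aG !eqxx.
by move=> /and3P[bG /eqP ob /eqP tb]; apply/esym/tree_arc_uniq.
Qed.

Lemma nbr_wt_unique a : a \in aset G -> org G a \in K -> ter G a \in K ->
  nbr_wt (org G a) (ter G a) = arc_wt G a.
Proof.
move=> aG oK tK; rewrite nbr_wtE ?tree_loopless // (big_pred1 a) // => b.
apply/idP/eqP => [|->]; last by rewrite aG !eqxx.
by move=> /and3P[bG /eqP ob /eqP tb]; apply/esym/tree_arc_uniq.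
Qed.

Lemma arc_sum_eq0 u v : u \in K -> ~~ e u v -> arc_sum u v = 0.
Proof.
move=> uK neuv; apply: big1 => a /and3P[aG /eqP oa /eqP ta].
by case/negP: neuv; rewrite -oa -ta arc_edge // tree_loopless // oa.
Qed.

Lemma arc_sum_conj u v : u \in K -> v \in K -> e u v ->
  arc_sum u v * arc_sum v u = ((nbr_wt u v)%:C)%C.
Proof.
move=> uK vK /edge_arc[a aG [ou tv]].
have ov : org G (ainv G a) = v by [].
have tu : ter G (ainv G a) = u by rewrite ter_ainv.
have := arc_sum_unique (ainv_aset aG); rewrite ov tu => -> //.
rewrite -ou -tv nbr_wt_unique ?ou ?tv // -ou -tv arc_sum_unique ?ou ?tv //.
by rewrite arc_wtE awt_ainv.
Qed.

Lemma tree_eigenvector : exists x : V -> R[i], (forall v, v \in K -> x v != 0) /\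
  forall v, v \in K ->
    x v * ((vwt G v)%:C)%C + \sum_(u in K) x u * arc_sum u v = (theta%:C)%C * x v.
Proof.
pose al v := (mu (K :\ v)).[theta]; pose be u v := (mu (K :\ u :\ v)).[theta].
have beC u v : be u v = be v u by rewrite /be setDDl setUC -setDDl.
have al0 v : v \in K -> al v != 0 by exact: crit_neq0.
have be0 u v : u \in K -> v \in K -> e u v -> be u v != 0 by exact: edge_neq0.
have w0 u v : e u v -> nbr_wt u v != 0 by rewrite /e lt0r => /andP[].
(* With this ratio [x u * arc_sum u v = x v * (nbr_wt v u * be v u / al v)], so the eigenvalue
   equation at [v] becomes the vertex recursion at [theta] divided by [al v]. Compatibility of [g]
   in both directions is [tree_edge]. *)
pose g u v := arc_sum u v * ((al v / (nbr_wt u v * be u v))%:C)%C.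
have [u v uK vK euv|x [x_neq0 xg]] := @tree_potential _ g.
  rewrite /g mulrACA arc_sum_conj // -!rmorphM /= [nbr_wt v u]nbr_wt_sym [be v u]beC.
  have -> : nbr_wt u v * (al v / (nbr_wt u v * be u v) * (al u / (nbr_wt u v * be u v)))
      = al u * al v / (nbr_wt u v * be u v ^+ 2).
    by field; rewrite w0 // be0.
  by rewrite [al u * al v]tree_edge // divff // mulf_neq0 ?w0 // expf_neq0 // be0.
exists x; split=> // v vK.
have term u : u \in K :\ v ->
    x u * arc_sum u v = x v * ((nbr_wt v u * be v u / al v)%:C)%C.
  case/setD1P => uv uK; have [euv|neuv] := boolP (e u v); last first.
    have -> : nbr_wt v u = 0.
      apply/eqP; move: neuv; rewrite e_sym /e lt0r nbr_wt_ge0 andbT negbK.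
      by [].
    by rewrite arc_sum_eq0 // !mul0r !mulr0.
  rewrite (xg u v) // /g -!mulrA -rmorphM /= [nbr_wt v u]nbr_wt_sym [be v u]beC.
  rewrite (_ : _ / _ * _ = 1) ?mulr1 //.
  by field; rewrite w0 // be0 // al0.
rewrite (big_setD1 v) //= arc_sum_eq0 ?e_irr // mulr0 add0r (eq_bigr _ term).
rewrite -mulr_sumr -(rmorph_sum (real_complex R)) /= -mulrDr -rmorphD /= mulrC.
congr (_ * _); rewrite -mulr_suml -(tree_vertex vK) mulfK ?al0 //.
by rewrite addrC subrK.
Qed.

Lemma tree_eigenvalue S : K \subset S -> S \subset vset G ->
  is_eigenvalue (induced (induced G S) K) theta.
Proof.
move=> KS SG; have [x [x_neq0 xE]] := tree_eigenvector.
set H := induced (induced G S) K.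
have HK : vset H = K.
  by rewrite /= /induced_vset /= /induced_vset -setIA (setIidPr KS) (setIidPr K_sub).
have enumK (i : 'I_#|vset H|) : enum_val i \in K by rewrite -HK enum_valP.
have arcH (i j : 'I_#|vset H|) :
    \sum_(a in aset H | (org H a == enum_val i) && (ter H a == enum_val j)) awt H a
    = arc_sum (enum_val i) (enum_val j) :> R[i].
  apply: eq_bigl => a; change (ter H a) with (ter G a); change (org H a) with (org G a).
  have -> : (a \in aset H) = [&& a \in aset G, (org G a \in S) && (ter G a \in S)
      & (org G a \in K) && (ter G a \in K)] by rewrite !inE -andbA.
  case: (org G a =P _) => [->|]; rewrite ?andbF //.
  case: (ter G a =P _) => [->|]; rewrite ?andbF //.
  by rewrite !(subsetP KS) !enumK ?andbT.
apply/eigenvalueP; exists (\row_i x (enum_val i)).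
  apply/rowP => j; rewrite !mxE; under eq_bigr do rewrite !mxE arcH mulrDr.
  rewrite big_split /= (bigD1 j) //= eqxx mulr1n [X in _ + X + _]big1 ?addr0; last first.
    by move=> i /negPf ->; rewrite mulr0n mulr0.
  rewrite -xE ?enumK //; congr (_ + _).
  rewrite -[RHS](eq_bigl _ _ (fun u => congr1 (fun X : {set V} => u \in X) HK)).
  by rewrite [RHS]big_enum_val.
have /set0Pn[v vK] := K_crit.1; have vH : v \in vset H by rewrite HK.
apply/eqP => /rowP/(_ (enum_rank_in vH v)); rewrite !mxE enum_rankK_in //.
by apply/eqP; apply: x_neq0.
Qed.

End TreeBlock.

Lemma blocks_components S : S \subset vset G -> blocks e (components (induced G S)) S.
Proof.
move=> SG; have HS : vset (induced G S) = S by rewrite /= /induced_vset (setIidPr SG).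
have adjS x y : adjacent (induced G S) x y = [&& x \in S, y \in S & adjacent G x y].
  apply/exists_inP/and3P => [[a aS /andP[/eqP <- /eqP <-]]|[xS yS]].
    have := aS; rewrite inE => /and3P[aG oS tS]; split=> //.
    by apply/exists_inP; exists a; rewrite // !eqxx.
  case/exists_inP=> a aG /andP[/eqP oa /eqP ta].
  exists a; first by rewrite inE aG oa ta xS.
  by change ((org G a == x) && (ter G a == y)); rewrite oa ta !eqxx.
rewrite /components HS; apply: blocks_connect.
- exact: e_irr.
- by move=> x y; rewrite !adjS adjacent_sym andbCA.
- by move=> x y; rewrite adjS => /and3P[].
by move=> x y xS yS xy; rewrite adjS xS yS adjacentE.
Qed.

Lemma cycle_in_block P S c : blocks e P S -> S \subset vset G -> is_cycle (induced G S) c ->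
  exists2 K, K \in P & is_cycle G c && (cycle_vset G c \subset K).
Proof.
move=> bP SG cS; have [/and3P[/eqP covP _ _] _ cP] := bP.
have /and5P[c0 /allP cS' cyc uc ainvc] := cS.
have arcS a : a \in c -> [/\ a \in aset G, org G a \in S & ter G a \in S].
  by move/cS'; rewrite inE => /and3P[].
case: c c0 cS cS' cyc uc ainvc arcS => // a c _ cS cS' cyc uc ainvc arcS.
have [aG oS _] := arcS a (mem_head _ _).
have := oS; rewrite -covP => /bigcupP[K KP aK]; exists K => //.
apply/andP; split.
  by apply/and5P; split=> //; apply/allP => b /arcS[].
have walk l b : {subset b :: l <= a :: c} -> org G b \in K ->
    path (fun p q => ter G p == org G q) b l -> forall d, d \in b :: l -> org G d \in K.
  elim: l b => [|b' l IHl] b sub bK /=; first by move=> _ d /[1!inE] /eqP->.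
  case/andP => /eqP tb pth d; rewrite inE => /predU1P[->//|].
  have [bG obS tbS] := arcS b (sub b (mem_head _ _)).
  apply: IHl => //; first by move=> z zl; apply: sub; rewrite inE zl orbT.
  rewrite -tb; have [<-//|ot] := eqVneq (org G b) (ter G b).
  exact: (cP K (org G b)) (arc_edge bG ot).
apply/subsetP => x; rewrite inE => /mapP[d dc ->]; apply: walk dc => //.
by move: cyc; rewrite /= rcons_path => /andP[].
Qed.

End Blocks.

(** * Disjoint cycles in the multi-graph *)

Theorem theorem36 (R : realType) (V A : finType) (G : wmgraph R V A)
    (theta : R) :
  (forall S : {set V}, ~ aomoto theta G S) ->
  exists C : 'I_(mult theta G) -> seq A,
    [/\ forall i, is_cycle G (C i),
        forall i j, i != j ->
          [disjoint cycle_vset G (C i) & cycle_vset G (C j)]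
      & mult theta (delete G (\bigcup_i cycle_vset G (C i))) = 0%N].
Proof.
move=> noAomoto; rewrite /mult matching_poly_mu.
pose e : rel V := fun x y => 0 < nbr_wt G x y.
have e_sym : symmetric e := weight_sym (@nbr_wt_sym _ _ _ G).
pose tree K := `[< forall c, ~ good_cycle G theta K c >].
have := barrier_cycles (@nbr_wt_ge0 _ _ _ G) (@nbr_wt_sym _ _ _ G)
  (mu_set0 G) (@muD1 _ _ _ G) (theta := theta) (@nbr_wt_diag _ _ _ G) (S := vset G) (tree := tree).
case=> [B P T BG bP TP Ttree|U [Udisj Untree] Ucyc].
  pose S := cover T; have [/and3P[/eqP covP _ _] lP cP] := bP.
  have bT : blocks e T S := blocks_cover bP TP.
  have KG K : K \in P -> K \subset vset G.
    move=> KP; apply: subset_trans (subsetDl _ B); rewrite -covP; exact: (bigcup_max K).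
  have SG : S \subset vset G.
    by apply/bigcupsP => K KT; apply: KG; apply: (subsetP TP).
  have cE : components (induced G S) = T := blocks_unique (blocks_components SG) bT.
  have treeK K : K \in T -> [/\ linked e K, critical (mu G) theta K, mup theta (mu G K) = 1%N
      & forall c, ~ good_cycle G theta K c].
    move=> KT; have [cK mK /asboolP tK] := Ttree K KT; split=> //.
    by apply: lP; apply: (subsetP TP).
  (* If the blocks in [T] had too few neighbors in [B], their union [S] would be an Aomoto
     subset. *)
  rewrite leqNgt; apply/negP => ltT; apply: (noAomoto S); split=> //.
  - move=> c; apply/negP => cS; have [K KT /andP[cG cK]] := cycle_in_block bT SG cS.
    have [lK crK mK tK] := treeK K KT.
    exact: (tree_acyclic lK crK mK tK cG cK).
  - move=> K; rewrite cE => KT; have [lK crK mK tK] := treeK K KT.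
    apply: (tree_eigenvalue (KG K (subsetP TP K KT)) lK crK mK tK) => //.
    by apply: (bigcup_max K).
  (* A frontier vertex outside [B] would lie in the block of its neighbor in [S], hence in [S]; so
     the frontier consists of vertices of [B] adjacent to blocks of [T]. *)
  rewrite cE; apply: leq_ltn_trans ltT; apply: subset_leq_card; apply/subsetP => x.
  case/setIdP => /setDP[xG xS] /exists_inP[y yS adj].
  have exy : e x y by rewrite /e -adjacentE //; apply: contraNneq xS => ->.
  have /bigcupP[K KT yK] := yS; rewrite inE; apply/andP; split.
    apply: contraT => xB; case/negP: xS; apply/bigcupP; exists K => //.
    have eyx : e y x by rewrite e_sym.
    by apply: cP yK _ eyx; rewrite ?(subsetP TP) // inE xB.
  by apply/exists_inP; exists K => //; apply/exists_inP; exists y.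
have /fin_all_exists[C CP] : forall i, exists c, good_cycle G theta (U i) c.
  move=> i; have /asboolPn := Untree i; apply: contra_notP => none c gc.
  by apply: none; exists c.
exists C; split=> [i|i j ij|]; first by case: (CP i).
  have [_ Ci _] := CP i; have [_ Cj _] := CP j.
  by apply: disjointWl Ci (disjointWr Cj (Udisj i j ij)).
rewrite /delete matching_poly_induced (setIidPr (subsetDl _ _)).
by apply: Ucyc => i; case: (CP i).
Qed.
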